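(* Let $A$ be a unitary $*$-algebra of the type $F+J(A)$ over a field $F$ of characteristic zero, generating a variety with quadratic codimension growth. For the multiplicities $m_{((1,1)_{t^\epsilon})}$ in the proper cocharacters of $A$, we have: (1) $m_{((1,1)_{0^+})}=1$ if and only if $U_{3,*} \in \mathrm{var}^*(A)$. (2) $m_{((1,1)_{0^-})}=1$ if and only if $\mathcal{G}_{2,\tau}\in \mathrm{var}^*(A)$. (3) $m_{((1,1)_{1^+})}=1$ if and only if $\mathcal{G}_{2,\psi}^{gr} \in \mathrm{var}^*(A)$. (4) $m_{((1,1)_{1^-})}=1$ if and only if $\mathcal{G}_{2,\tau}^{gr}\in \mathrm{var}^*(A)$.
   Context: Throughout, $F$ is a field of characteristic zero and algebras are associative over $F$. A superalgebra is an algebra $A=A_0\oplus A_1$ with $A_iA_j\subseteq A_{i+j}$ (indices mod 2); we also write $A=(A_0,A_1)$. The trivial grading is $(A,0)$. A superinvolution on $A$ is a linear map $*:A\to A$ with $A_i^*\subseteq A_i$, $(a^* )^*=a$ and $(ab)^*=(-1)^{|a||b|}b^*a^*$ for all homogeneous $a,b$. A $*$-algebra is a superalgebra with a superinvolution; it is unitary if it has a unit. Put $A_i^{+}=\{a\in A_i: a^*=a\}$, $A_i^-=\{a\in A_i:a^*=-a\}$. $J(A)$ is the Jacobson radical; ''of the type $F+J(A)$'' means $A=F1_A+J(A)$. Let $\mathcal F$ be the free associative algebra on the disjoint sets $X_i^\varepsilon=\{x_{1,i}^\varepsilon,x_{2,i}^\varepsilon,\dots\}$, $i\in\{0,1\}$,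 $\varepsilon\in\{+,-\}$, where variables in $X_i^\varepsilon$ have degree $i$ and are symmetric ($\varepsilon=+$) or skew ($\varepsilon=-$). $\mathrm{Id}^*(A)$ is the set of $f\in\mathcal F$ (the $*$-identities) vanishing under all substitutions sending each $x_{j,i}^\varepsilon$ into $A_i^\varepsilon$, and $\mathrm{var}^*(A)$ is the class of all $*$-algebras $B$ with $\mathrm{Id}^*(A)\subseteq\mathrm{Id}^*(B)$. $P_n^*$ is the span of all $w_{\sigma(1)}\cdots w_{\sigma(n)}$, $\sigma\in S_n$, $w_j\in\{x_{j,0}^+,x_{j,0}^-,x_{j,1}^+,x_{j,1}^-\}$, and $c_n^*(A)=\dim_F P_n^*/(P_n^*\cap \mathrm{Id}^*(A))$. Quadratic codimension growth means $\lim_{n\to\infty}c_n^*(A)/(\alpha n^2)=1$ for some $\alpha\ne0$. A multilinear polynomial is proper if it is a linear combination of products of variables from $X_0^-$, then variables from $X_1^+$, then variables from $X_1^-$, followed by (left-normed) commutators of length at least 2 in arbitrary variables. For $n=n_1+\cdots+n_4$, $\Gamma_{n_1,\dots,n_4}$ is the space of proper multilinear polynomials of degree $n$ in which the first $n_1$ variables are symmetric of degree 0, the next $n_2$ skew of degree 0, the next $n_3$ symmetric of degree 1, the last $n_4$ skew of degree 1. The group $S_{n_1}\times\cdots\times S_{n_4}$ acts by permuting variables of the same type, and the character of $\Gamma_{n_1,\dots,n_4}(A)=\Gamma_{n_1,\dots,n_4}/(\Gamma_{n_1,\dots,n_4}\cap\mathrm{Id}^*(A))$ decomposes as $\pi_{n_1,\dots,n_4}(A)=\sum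 m_{\lambda_1,\dots,\lambda_4}\,\chi_{\lambda_1}\otimes\cdots\otimes\chi_{\lambda_4}$, summed over $\lambda_i\vdash n_i$ (the proper cocharacter of $A$). A multipartition is written $((\lambda_1)_{0^+},(\lambda_2)_{0^-},(\lambda_3)_{1^+},(\lambda_4)_{1^-})$ with empty partitions omitted; e.g. $m_{((1,1)_{0^+})}$ is the multiplicity for $(n_1,\dots,n_4)=(2,0,0,0)$ and $\lambda_1=(1,1)$. Algebras: $U_{3,*}$ is the algebra $U_3=\mathrm{span}\{I_6,\ e_{23}+e_{45},\ e_{12}+e_{56},\ e_{13},\ e_{46}\}$ of $6\times 6$ upper triangular matrices ($e_{ij}$ matrix units, $I_6$ identity) with trivial grading and reflection superinvolution $e_{ij}\mapsto e_{7-j,7-i}$. $\mathcal G_2=\langle 1,e_1,e_2\mid e_ie_j=-e_je_i,\ i,j=1,2\rangle$ (basis $1,e_1,e_2,e_1e_2$), and $\mathcal G_2^{gr}$ is $\mathcal G_2$ with grading $(F1+Fe_1e_2,\,Fe_1+Fe_2)$. Superinvolutions are determined by $\psi(e_i)=e_i$, $\tau(e_i)=-e_i$ ($i=1,2$). $\mathcal G_{2,\tau}$ is $\mathcal G_2$ with trivial grading and superinvolution $\tau$; $\mathcal G_{2,\psi}^{gr}$, $\mathcal G_{2,\tau}^{gr}$ are $\mathcal G_2^{gr}$ with superinvolution $\psi$, resp. $\tau$. *)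

(* Defs.v *)
From HB Require Import structures.
From mathcomp Require Import all_boot all_order all_algebra all_fingroup.
From mathcomp Require Import mxrepresentation ring.
From mathcomp Require Import boolp classical_sets reals topology normedtype.
(* The notations of monalg are incompatible with those of topology.           *)
From mathcomp.multinomials Require Import -(notations) monalg.

Set Implicit Arguments.
Unset Strict Implicit.
Unset Printing Implicit Defensive.

Import Order.TTheory GRing.Theory Num.Theory.
Import numFieldNormedType.Exports.

Local Open Scope classical_set_scope.
Local Open Scope ring_scope.

Section LinearSets.
Variables (F : fieldType) (L : lmodType F).

Definition lin_span (S : set L) : set L :=
  [set v | exists (k : nat) (c : 'I_k -> F) (u : 'I_k -> L),
    (forall i, S (u i)) /\ v = \sum_i c i *: u i].

(* The classes of the b i form a basis of V / (V :&: W). *)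
Definition basis_mod (V W : set L) (d : nat) (b : 'I_d -> L) : Prop :=
  [/\ forall i, V (b i),
      forall c : 'I_d -> F, W (\sum_i c i *: b i) -> forall i, c i = 0
    & forall v, V v -> exists c : 'I_d -> F, W (v - \sum_i c i *: b i)].

(* dim (V / (V :&: W)), with value 0 if this dimension is infinite. *)
Definition dim_mod (V W : set L) : nat :=
  xget 0%N [set d | exists b : 'I_d -> L, basis_mod V W b].

End LinearSets.

(* Unitary superalgebras with superinvolution; [homog false] and [homog true] *)
(* are the components of degree 0 and 1.                                      *)
Record starAlg (F : fieldType) := StarAlg {
  starAlg_sort :> algType F;
  homog : bool -> set starAlg_sort;
  star : starAlg_sort -> starAlg_sort;
  homog0 : forall i, homog i 0;
  homogP : forall i c x y, homog i x -> homog i y -> homog i (c *: x + y);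
  homog_decomp : forall a, exists a0 a1,
    [/\ homog false a0, homog true a1 & a = a0 + a1];
  homog_direct : forall a, homog false a -> homog true a -> a = 0;
  homogM : forall i j a b, homog i a -> homog j b -> homog (i (+) j) (a * b);
  star_linear : forall c x y, star (c *: x + y) = c *: star x + star y;
  star_homog : forall i a, homog i a -> homog i (star a);
  starK : forall a, star (star a) = a;
  starM : forall i j a b, homog i a -> homog j b ->
    star (a * b) = (-1) ^+ (i && j) *: (star b * star a)
}.

(* A variable type (i, e) consists of a degree i and a sign e, where          *)
(* e = false stands for "symmetric" and e = true for "skew".                  *)
Definition vtype : Type := bool * bool.
Definition sym0 : vtype := (false, false).
Definition skew0 : vtype := (false, true).
Definition sym1 : vtype := (true, false).
Definition skew1 : vtype := (true, true).

(* A_i^+ and A_i^- *)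
Definition signed_part (F : fieldType) (A : starAlg F) (t : vtype) : set A :=
  [set a | homog t.1 a /\ star a = (-1) ^+ t.2 *: a].
Arguments signed_part {F} A t _.

(* Variables are numbered from 0: (t, j) stands for x_{j+1} of type t. *)
Definition var : Type := bool * bool * nat.

HB.instance Definition _ := Choice.copy var (bool * bool * nat)%type.

(* The free associative (unitary) algebra on the variables: the algebra of    *)
(* the free monoid of words.                                                  *)
Notation freeAlg F := (malg (fmonom var) F).

Section FreeAlgebra.
Variable F : fieldType.

Definition fvar (v : var) : freeAlg F := mkmalgU (FMonom [:: v]) 1.

Definition evalX (B : lalgType F) (phi : var -> B) (f : freeAlg F) : B :=
  mmap (fun c : F => c%:A) (fun w : fmonom var => \prod_(v <- w) phi v) f.

Definition lie (a b : freeAlg F) := a * b - b * a.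

(* The left-normed commutator [v_1, ..., v_k]. *)
Definition lcomm (c : seq var) : freeAlg F :=
  if c is v :: c' then foldl lie (fvar v) [seq fvar w | w <- c'] else 1.

Definition star_id (A : starAlg F) : set (freeAlg F) :=
  [set f : freeAlg F | forall phi : var -> A,
    (forall v, signed_part A v.1 (phi v)) -> evalX phi f = 0].

(* B belongs to the variety generated by A *)
Definition in_var (A B : starAlg F) : Prop := star_id A `<=` star_id B.

(* t j is the type of w_j *)
Definition multilinear_polys (n : nat) : set (freeAlg F) :=
  lin_span [set p : freeAlg F | exists (s : 'S_n) (t : 'I_n -> vtype),
    p = \prod_(j < n) fvar (t (s j), s j : nat)].

Definition star_codim (A : starAlg F) (n : nat) : nat :=
  dim_mod (multilinear_polys n) (star_id A).

Definition quadratic_growth (R : realType) (A : starAlg F) : Prop :=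
  exists2 alpha : R, alpha != 0 &
    (fun n : nat => (star_codim A n)%:R / (alpha * n%:R ^+ 2) : R) @ \oo --> (1 : R).

Definition block (t : vtype) (off n : nat) : seq var :=
  [seq (t, j) | j <- iota off n].

(* x_1, ..., x_n with the first n1 variables symmetric of degree 0, etc. *)
Definition proper_vars (n1 n2 n3 n4 : nat) : seq var :=
  block sym0 0 n1 ++ block skew0 n1 n2
  ++ block sym1 (n1 + n2)%N n3 ++ block skew1 (n1 + n2 + n3)%N n4.

Definition of_type (t : vtype) (s : seq var) : bool :=
  all (fun v : var => v.1 == t) s.

Definition proper_polys (n1 n2 n3 n4 : nat) : set (freeAlg F) :=
  lin_span [set p : freeAlg F | exists (ys zs ws : seq var) (cs : seq (seq var)),
    [/\ [/\ of_type skew0 ys, of_type sym1 zs & of_type skew1 ws],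
        all (fun c => (1 < size c)%N) cs,
        perm_eq (ys ++ zs ++ ws ++ flatten cs) (proper_vars n1 n2 n3 n4)
      & p = \prod_(v <- ys) fvar v * \prod_(v <- zs) fvar v * \prod_(v <- ws) fvar v
            * \prod_(c <- cs) lcomm c]].

(* s acting on {off, ..., off + n - 1}, fixing all other numbers *)
Definition shift_perm (off n : nat) (s : 'S_n) (j : nat) : nat :=
  if (off <= j)%N then
    if insub (j - off)%N is Some k then (off + (s k : 'I_n))%N else j
  else j.

Definition perm_var n1 n2 n3 n4
    (s1 : 'S_n1) (s2 : 'S_n2) (s3 : 'S_n3) (s4 : 'S_n4) (v : var) : var :=
  (v.1, match v.1 with
        | (false, false) => shift_perm 0 s1 v.2
        | (false, true) => shift_perm n1 s2 v.2
        | (true, false) => shift_perm (n1 + n2)%N s3 v.2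
        | (true, true) => shift_perm (n1 + n2 + n3)%N s4 v.2
        end).

Definition perm_act n1 n2 n3 n4
    (s1 : 'S_n1) (s2 : 'S_n2) (s3 : 'S_n3) (s4 : 'S_n4) :
    freeAlg F -> freeAlg F :=
  evalX (fun v => fvar (perm_var s1 s2 s3 s4 v)).

End FreeAlgebra.

Arguments star_id {F} A _.
Arguments multilinear_polys F n _ : clear implicits.
Arguments proper_polys F n1 n2 n3 n4 _ : clear implicits.

(* Partitions of n, as nonincreasing lists of positive integers. *)
Definition is_partition (n : nat) (l : seq nat) : bool :=
  [&& sorted geq l, 0%N \notin l & sumn l == n].

(* The lists of length k with entries in {1, ..., n}. *)
Definition words (n k : nat) : seq (seq nat) :=
  iter k (allpairs cons (iota 1 n)) [:: [::]].

Definition partitions (n : nat) : seq (seq nat) :=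
  [seq l <- flatten [seq words n k | k <- iota 0 n.+1] | is_partition n l].

Lemma mem_partitions n l : (l \in partitions n) = is_partition n l.
Proof.
rewrite /partitions mem_filter andb_idr // => /and3P[_ l0 /eqP sn].
have wordsP k (w : seq nat) : size w = k -> {subset w <= iota 1 n} ->
    w \in words n k.
  elim: k w => [|k IHk] [|x w] //= [sw] sub; apply: allpairs_f.
    by apply: sub; rewrite mem_head.
  by apply: IHk => // y yw; apply: sub; rewrite inE yw orbT.
have le_n x : x \in l -> (x <= n)%N.
  by move=> xl; rewrite -sn (perm_sumn (perm_to_rem xl)) /= leq_addr.
have gt0 x : x \in l -> (0 < x)%N.
  by move=> xl; case: x xl l0 => // ->.
apply/flattenP; exists (words n (size l)).
  apply: map_f; rewrite mem_iota ltnS -sn sumnE -sum1_size.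
  by rewrite !(big_seq_cond xpredT) leq_sum // => x /andP[xl _]; apply: gt0.
by apply: wordsP => // x xl; rewrite mem_iota gt0 ?add1n ?ltnS ?le_n.
Qed.

Lemma partitions_uniq n : uniq (partitions n).
Proof.
apply: filter_uniq.
have size_words k w : w \in words n k -> size w = k.
  elim: k w => [|k IHk] w /=; first by rewrite inE => /eqP->.
  by case/allpairsP => -[x v] [_ /= /IHk <- ->].
have uniq_words k : uniq (words n k).
  by elim: k => //= k IHk; apply: allpairs_uniq => // [|[x v] [y w] _ _ [-> ->]];
    rewrite ?iota_uniq.
elim: n.+1 0%N => //= m IHm j; rewrite cat_uniq uniq_words IHm andbT /=.
apply/hasPn => w /flattenP[_ /mapP[k + ->] /size_words wk].
rewrite mem_iota => /andP[lt_jk _]; apply: contraTN lt_jk => /size_words.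
by rewrite wk => ->; rewrite ltnn.
Qed.

Section Specht.
Variables (F : fieldType) (l : seq nat) (n : nat).

(* The Young tableau of shape l filled row by row with 0, ..., n - 1: the     *)
(* entry i lies in row [reshape_index l i] and column [reshape_offset l i].   *)
Definition row_stab : {set 'S_n} :=
  [set s : 'S_n |
    [forall i : 'I_n, reshape_index l (s i) == reshape_index l i]]%SET.

Definition col_stab : {set 'S_n} :=
  [set s : 'S_n |
    [forall i : 'I_n, reshape_offset l (s i) == reshape_offset l i]]%SET.

(* The Young symmetrizer, an element of the group algebra of S_n. *)
Definition young_sym : 'rV[F]_#|[set: 'S_n]%G| :=
  \sum_(r in row_stab) \sum_(c in col_stab)
    (-1) ^+ odd_perm c *: delta_mx 0 (gring_index [set: 'S_n]%G (r * c)%g).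

(* chi_l : the character of the ideal generated by the Young symmetrizer. *)
Definition specht_char (s : 'S_n) : F :=
  \tr (submod_repr
         (cyclic_mx_module (regular_repr F [set: 'S_n]%G) young_sym) s).

End Specht.

Arguments specht_char F l {n} s.

Section Cocharacter.
Variable F : fieldType.

(* The character of Gamma_{n1,n2,n3,n4}(A) is the sum, over all partitions    *)
(* li of ni, of m l1 l2 l3 l4 times chi_l1 (x) chi_l2 (x) chi_l3 (x) chi_l4.  *)
Definition proper_cocharacter (A : starAlg F) (n1 n2 n3 n4 : nat)
    (m : seq nat -> seq nat -> seq nat -> seq nat -> nat) : Prop :=
  exists (d : nat) (b : 'I_d -> freeAlg F),
    basis_mod (proper_polys F n1 n2 n3 n4) (star_id A) b /\
    forall (s1 : 'S_n1) (s2 : 'S_n2) (s3 : 'S_n3) (s4 : 'S_n4) (M : 'M[F]_d),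
      (forall i, star_id A (perm_act s1 s2 s3 s4 (b i) - \sum_j M i j *: b j)) ->
      \tr M = \sum_(l1 <- partitions n1) \sum_(l2 <- partitions n2)
              \sum_(l3 <- partitions n3) \sum_(l4 <- partitions n4)
                (m l1 l2 l3 l4)%:R *
                (specht_char F l1 s1 * specht_char F l2 s2 *
                 specht_char F l3 s3 * specht_char F l4 s4).

(* m_{((l1)_{0+}, (l2)_{0-}, (l3)_{1+}, (l4)_{1-})} *)
Definition proper_mult (A : starAlg F) (l1 l2 l3 l4 : seq nat) : nat :=
  xget 0%N [set k | exists2 m,
    proper_cocharacter A (sumn l1) (sumn l2) (sumn l3) (sumn l4) m
    & m l1 l2 l3 l4 = k].

End Cocharacter.

Section Jacobson.
Variable A : nzRingType.

Definition left_ideal (I : set A) : Prop :=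
  [/\ I 0, forall x y, I x -> I y -> I (x + y) & forall a x, I x -> I (a * x)].

Definition maximal_left_ideal (I : set A) : Prop :=
  [/\ left_ideal I, ~ I 1
    & forall K, left_ideal K -> I `<=` K -> ~ K 1 -> K `<=` I].

Definition jacobson : set A :=
  [set x | forall I, maximal_left_ideal I -> I x].

End Jacobson.

Definition type_F_plus_J (F : fieldType) (A : starAlg F) : Prop :=
  forall a : A, exists (c : F) (j : A), jacobson j /\ a = c%:A + j.

(* The Grassmann algebra on e_1, e_2: the row (a b c d) stands for            *)
(* a + b e_1 + c e_2 + d e_1 e_2.                                             *)
Section Grassmann.
Variable F : fieldType.

Definition G2 : Type := 'rV[F]_4.
HB.instance Definition _ := GRing.Lmodule.on G2.

Definition G2_mk (a b c d : F) : G2 := \row_(i < 4) [:: a; b; c; d]`_i.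

Definition G2_coef (x : G2) (i : nat) : F := x 0 (inord i).

Lemma G2_coefE a b c d i : (i < 4)%N ->
  G2_coef (G2_mk a b c d) i = [:: a; b; c; d]`_i.
Proof. by move=> lti; rewrite /G2_coef mxE inordK. Qed.

Lemma G2P (x y : G2) : G2_coef x 0 = G2_coef y 0 -> G2_coef x 1 = G2_coef y 1 ->
  G2_coef x 2 = G2_coef y 2 -> G2_coef x 3 = G2_coef y 3 -> x = y.
Proof.
move=> e0 e1 e2 e3; apply/rowP => i; rewrite -(inord_val i).
by case: i => [[|[|[|[|//]]]]] /= _.
Qed.

Definition G2_one : G2 := G2_mk 1 0 0 0.

Definition G2_mul (x y : G2) : G2 :=
  let a := G2_coef x in let b := G2_coef y in
  G2_mk (a 0 * b 0) (a 0 * b 1 + a 1 * b 0) (a 0 * b 2 + a 2 * b 0)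
        (a 0 * b 3 + a 1 * b 2 - a 2 * b 1 + a 3 * b 0).

Lemma G2_coefD x y i : G2_coef (x + y) i = G2_coef x i + G2_coef y i.
Proof. by rewrite /G2_coef mxE. Qed.
Lemma G2_coefZ c x i : G2_coef (c *: x) i = c * G2_coef x i.
Proof. by rewrite /G2_coef mxE. Qed.
Lemma G2_coef0 i : G2_coef 0 i = 0.
Proof. by rewrite /G2_coef mxE. Qed.

Let G2E := (G2_coefD, G2_coefZ, G2_coef0, G2_coefE).

Fact G2_mulA : associative G2_mul.
Proof. by move=> x y z; apply: G2P; rewrite !G2E //=; ring. Qed.
Fact G2_mul1 : left_id G2_one G2_mul.
Proof. by move=> x; apply: G2P; rewrite !G2E //=; ring. Qed.
Fact G2_mulr1 : right_id G2_one G2_mul.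
Proof. by move=> x; apply: G2P; rewrite !G2E //=; ring. Qed.
Fact G2_mulDl : left_distributive G2_mul +%R.
Proof. by move=> x y z; apply: G2P; rewrite !G2E //=; ring. Qed.
Fact G2_mulDr : right_distributive G2_mul +%R.
Proof. by move=> x y z; apply: G2P; rewrite !G2E //=; ring. Qed.
Fact G2_one_neq0 : G2_one != 0.
Proof.
apply/eqP => /(congr1 (fun x => G2_coef x 0)).
by rewrite !G2E //= => /eqP; rewrite oner_eq0.
Qed.
HB.instance Definition _ := GRing.Zmodule_isNzRing.Build G2
  G2_mulA G2_mul1 G2_mulr1 G2_mulDl G2_mulDr G2_one_neq0.

Fact G2_scaleAl (c : F) (x y : G2) : c *: (x * y) = (c *: x) * y.
Proof. by apply: G2P; rewrite !G2E //=; ring. Qed.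
HB.instance Definition _ := GRing.Lmodule_isLalgebra.Build F G2 G2_scaleAl.
Fact G2_scaleAr (c : F) (x y : G2) : c *: (x * y) = x * (c *: y).
Proof. by apply: G2P; rewrite !G2E //=; ring. Qed.
HB.instance Definition _ := GRing.Lalgebra_isAlgebra.Build F G2 G2_scaleAr.

End Grassmann.

Section TrivialGrading.
Variables (F : fieldType) (A : algType F) (st : A -> A).
Hypothesis st_lin : forall c x y, st (c *: x + y) = c *: st x + st y.
Hypothesis stK : forall a, st (st a) = a.
Hypothesis stM : forall a b, st (a * b) = st b * st a.

Definition trivial_homog (i : bool) : set A := if i then [set 0] else setT.

Let st0 : st 0 = 0.
Proof. by have := st_lin (-1) 0 0; rewrite !scaleN1r !addNr. Qed.

Fact trivial_homog0 i : trivial_homog i 0.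
Proof. by case: i. Qed.
Fact trivial_homogP i c x y : trivial_homog i x -> trivial_homog i y ->
  trivial_homog i (c *: x + y).
Proof. by case: i => //= -> ->; rewrite scaler0 addr0. Qed.
Fact trivial_homog_decomp a : exists a0 a1,
  [/\ trivial_homog false a0, trivial_homog true a1 & a = a0 + a1].
Proof. by exists a, 0; rewrite addr0. Qed.
Fact trivial_homog_direct a :
  trivial_homog false a -> trivial_homog true a -> a = 0.
Proof. by []. Qed.
Fact trivial_homogM i j a b : trivial_homog i a -> trivial_homog j b ->
  trivial_homog (i (+) j) (a * b).
Proof. by case: i j => [] [] //= => [-> _|_ ->]; rewrite ?mul0r ?mulr0. Qed.
Fact trivial_star_homog i a : trivial_homog i a -> trivial_homog i (st a).
Proof. by case: i => //= ->; rewrite st0. Qed.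
Fact trivial_starM i j a b : trivial_homog i a -> trivial_homog j b ->
  st (a * b) = (-1) ^+ (i && j) *: (st b * st a).
Proof.
case: i j => [] [] /=; rewrite ?expr0 ?scale1r ?stM // => -> _.
by rewrite st0 mulr0 scaler0.
Qed.

Definition trivial_starAlg : starAlg F :=
  StarAlg trivial_homog0 trivial_homogP trivial_homog_decomp
    trivial_homog_direct trivial_homogM st_lin trivial_star_homog stK
    trivial_starM.

End TrivialGrading.

Section GrassmannStar.
Variable F : fieldType.
Local Notation G2 := (G2 F).
Local Notation e1 := (G2_mk 0 1 0 0 : G2).
Local Notation e2 := (G2_mk 0 0 1 0 : G2).

Let G2E := (@G2_coefD F, @G2_coefZ F, @G2_coef0 F, @G2_coefE F).

Lemma G2_decomp (x : G2) : x = G2_coef x 0 *: 1 + G2_coef x 1 *: e1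
  + G2_coef x 2 *: e2 + G2_coef x 3 *: (e1 * e2).
Proof. by apply: G2P; rewrite !G2E //=; ring. Qed.

Lemma G2_e1e1 : e1 * e1 = 0.
Proof. by apply: G2P; rewrite !G2E //=; ring. Qed.
Lemma G2_e2e2 : e2 * e2 = 0.
Proof. by apply: G2P; rewrite !G2E //=; ring. Qed.
Lemma G2_e2e1 : e2 * e1 = - (e1 * e2).
Proof. by rewrite -scaleN1r; apply: G2P; rewrite !G2E //=; ring. Qed.

(* e_1 |-> s e_1, e_2 |-> s e_2, e_1 e_2 |-> t e_1 e_2 *)
Definition G2_star (s t : F) (x : G2) : G2 :=
  G2_mk (G2_coef x 0) (s * G2_coef x 1) (s * G2_coef x 2) (t * G2_coef x 3).

Fact G2_star_linear s t c x y :
  G2_star s t (c *: x + y) = c *: G2_star s t x + G2_star s t y.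
Proof. by apply: G2P; rewrite !G2E //=; ring. Qed.
Fact G2_starK s t : s ^+ 2 = 1 -> t ^+ 2 = 1 ->
  forall x, G2_star s t (G2_star s t x) = x.
Proof.
by move=> ss tt x; apply: G2P; rewrite !G2E //= mulrA -expr2 ?ss ?tt mul1r.
Qed.

(* tau on the trivially graded algebra: (e_1 e_2)^* = e_2^* e_1^* = - e_1 e_2 *)
Fact G2_tauK x : G2_star (-1) (-1) (G2_star (-1) (-1) x) = x.
Proof. by apply: G2_starK; rewrite sqrrN expr1n. Qed.
Fact G2_tauM x y : G2_star (-1) (-1) (x * y) =
  G2_star (-1) (-1) y * G2_star (-1) (-1) x.
Proof. by apply: G2P; rewrite !G2E //=; ring. Qed.

Definition G2_tau : starAlg F :=
  trivial_starAlg (@G2_star_linear (-1) (-1)) G2_tauK G2_tauM.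

(* The grading (F 1 + F e_1 e_2, F e_1 + F e_2). For both psi and tau,        *)
(* (e_1 e_2)^* = - e_2^* e_1^* = e_1 e_2.                                     *)
Definition G2_homog (i : bool) : set G2 :=
  if i then [set x | exists b c, x = b *: e1 + c *: e2]
  else [set x | exists a d, x = a *: 1 + d *: (e1 * e2)].

Lemma G2_homogE i x : G2_homog i x <->
  if i then G2_coef x 0 = 0 /\ G2_coef x 3 = 0
  else G2_coef x 1 = 0 /\ G2_coef x 2 = 0.
Proof.
case: i => /=; split.
- by move=> [b [c ->]]; rewrite !G2E //=; split; ring.
- move=> [x0 x3]; exists (G2_coef x 1), (G2_coef x 2).
  by rewrite {1}[x]G2_decomp x0 x3 !scale0r add0r addr0.
- by move=> [b [c ->]]; rewrite !G2E //=; split; ring.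
- move=> [x1 x2]; exists (G2_coef x 0), (G2_coef x 3).
  by rewrite {1}[x]G2_decomp x1 x2 !scale0r !addr0.
Qed.

Fact G2_homog0 i : G2_homog i 0.
Proof. by apply/G2_homogE; case: i; rewrite !G2E. Qed.
Fact G2_homogP i c x y : G2_homog i x -> G2_homog i y -> G2_homog i (c *: x + y).
Proof.
move=> /G2_homogE hx /G2_homogE hy; apply/G2_homogE.
by case: i hx hy => -[hx hx'] [hy hy']; rewrite !G2E hx hx' hy hy' mulr0 addr0.
Qed.
Fact G2_homog_decomp a : exists a0 a1,
  [/\ G2_homog false a0, G2_homog true a1 & a = a0 + a1].
Proof.
exists (G2_coef a 0 *: 1 + G2_coef a 3 *: (e1 * e2)).
exists (G2_coef a 1 *: e1 + G2_coef a 2 *: e2); split.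
- by exists (G2_coef a 0), (G2_coef a 3).
- by exists (G2_coef a 1), (G2_coef a 2).
- by rewrite {1}[a]G2_decomp addrACA addrA addrAC.
Qed.
Fact G2_homog_direct a : G2_homog false a -> G2_homog true a -> a = 0.
Proof.
move=> /G2_homogE[? ?] /G2_homogE[? ?].
by apply: G2P; rewrite !G2E.
Qed.
Fact G2_homogM i j a b : G2_homog i a -> G2_homog j b ->
  G2_homog (i (+) j) (a * b).
Proof.
move=> /G2_homogE ha /G2_homogE hb; apply/G2_homogE.
by case: i j ha hb => [] [] /= [ha ha'] [hb hb'];
  rewrite !G2E //= ?ha ?ha' ?hb ?hb'; split; ring.
Qed.
Fact G2_star_homog s i a : G2_homog i a -> G2_homog i (G2_star s 1 a).
Proof.
move=> /G2_homogE ha; apply/G2_homogE.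
by case: i ha => -[ha ha']; rewrite !G2E //= ha ha' !mulr0.
Qed.
Fact G2_gr_starM s : s ^+ 2 = 1 -> forall i j a b,
  G2_homog i a -> G2_homog j b ->
  G2_star s 1 (a * b) = (-1) ^+ (i && j) *: (G2_star s 1 b * G2_star s 1 a).
Proof.
move=> ss i j a b /G2_homogE ha /G2_homogE hb.
by case: i j ha hb => [] [] /= [ha ha'] [hb hb'];
  apply: G2P; rewrite !G2E //= ?ha ?ha' ?hb ?hb'; ring: ss.
Qed.

Definition G2_gr (s : F) (ss : s ^+ 2 = 1) : starAlg F :=
  StarAlg G2_homog0 G2_homogP G2_homog_decomp G2_homog_direct G2_homogM
    (@G2_star_linear s 1) (@G2_star_homog s) (G2_starK ss (expr1n F 2))
    (G2_gr_starM ss).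

Definition G2_gr_psi : starAlg F := G2_gr (expr1n F 2).
Definition G2_gr_tau : starAlg F := G2_gr (etrans (sqrrN 1) (expr1n F 2)).

End GrassmannStar.

(* U_3 with the reflection e_ij |-> e_{7-j,7-i}; e i j is the matrix unit     *)
(* e_ij, numbered from 1.                                                     *)
Section U3.
Variable F : fieldType.

Local Notation e i j := (delta_mx (inord i.-1) (inord j.-1) : 'M[F]_6).

Definition U3_gens : seq 'M[F]_6 :=
  [:: 1; e 2 3 + e 4 5; e 1 2 + e 5 6; e 1 3; e 4 6].

Definition U3_pred : {pred 'M[F]_6} := fun M => M \in <<U3_gens>>%VS.

Lemma U3_mul_gens i j : (i < 5)%N -> (j < 5)%N ->
  U3_gens`_i * U3_gens`_j \in <<U3_gens>>%VS.
Proof.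
have g k : (k < 5)%N -> U3_gens`_k \in <<U3_gens>>%VS.
  by move=> ltk; apply/memv_span/mem_nth.
have mE (a d : 'I_6) b c : (b < 6)%N -> (c < 6)%N ->
    delta_mx a (inord b) * delta_mx (inord c) d = delta_mx a d *+ (b == c)
    :> 'M[F]_6.
  move=> b6 c6; rewrite -[LHS]/(_ *m _) mul_delta_mx_cond.
  by rewrite -val_eqE /= !inordK.
case: i => [|i] lti; first by rewrite mul1r => /g.
case: j => [|j] ltj; first by rewrite mulr1 g.
by case: i j lti ltj => [|[|[|[|//]]]] [|[|[|[|//]]]] _ _ /=;
  rewrite ?mulrDl ?mulrDr !mE //= ?mulr0n ?mulr1n ?addr0 ?add0r ?mem0v //;
  first [exact: (g 3) | exact: (g 4)].
Qed.

Fact U3_subalg : subalg_closed U3_pred.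
Proof.
split=> [|c x y xU yU|x y xU yU]; rewrite /in_mem /= /U3_pred.
- exact: (@memv_span _ _ U3_gens 1 (mem_head _ _)).
- by apply: rpredD => //; apply: rpredZ.
- rewrite (coord_span (X := in_tuple U3_gens) xU).
  rewrite (coord_span (X := in_tuple U3_gens) yU).
  rewrite mulr_suml; apply: rpred_sum => i _.
  rewrite mulr_sumr; apply: rpred_sum => j _.
  by rewrite -scalerAl -scalerAr !rpredZ ?U3_mul_gens.
Qed.
HB.instance Definition _ := GRing.isSubalgClosed.Build F 'M[F]_6 U3_pred U3_subalg.

Record U3 : predArgType := MkU3 { U3_val : 'M[F]_6; _ : U3_val \in U3_pred }.
HB.instance Definition _ := [isSub for U3_val].
HB.instance Definition _ := [Choice of U3 by <:].
HB.instance Definition _ := [SubChoice_isSubAlgebra of U3 by <:].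

Definition reflection (M : 'M[F]_6) : 'M[F]_6 :=
  \matrix_(i, j) M (rev_ord j) (rev_ord i).

Lemma reflection_linear c M N :
  reflection (c *: M + N) = c *: reflection M + reflection N.
Proof. by apply/matrixP => i j; rewrite !mxE. Qed.

Lemma reflectionK : involutive reflection.
Proof. by move=> M; apply/matrixP => i j; rewrite !mxE !rev_ordK. Qed.

Lemma reflectionM M N : reflection (M * N) = reflection N * reflection M.
Proof.
apply/matrixP => i j; rewrite !mxE (reindex_inj rev_ord_inj) /=.
by apply: eq_bigr => k _; rewrite !mxE mulrC.
Qed.

Lemma reflection_delta i j : (i < 6)%N -> (j < 6)%N ->
  reflection (delta_mx (inord i) (inord j)) =
  delta_mx (inord (5 - j)) (inord (5 - i)).
Proof.
have rev_inord k : (k < 6)%N -> rev_ord (inord k) = inord (5 - k) :> 'I_6.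
  move=> lt6; apply/val_inj; rewrite /= !inordK ?ltnS ?leq_subr //.
move=> i6 j6; rewrite -!rev_inord //; apply/matrixP => k l.
by rewrite !mxE andbC; rewrite !(can2_eq rev_ordK rev_ordK).
Qed.

Lemma reflection_e i j : (0 < i <= 6)%N -> (0 < j <= 6)%N ->
  reflection (e i j) = e (7 - j) (7 - i).
Proof.
move=> /andP[i0 i6] /andP[j0 j6]; rewrite reflection_delta ?prednK //.
by case: i i0 {i6} => // i _; case: j j0 {j6} => // j _; rewrite -!subnS.
Qed.

Lemma reflection_gens i : (i < 5)%N -> reflection U3_gens`_i \in U3_gens.
Proof.
have rD M N : reflection (M + N) = reflection M + reflection N.
  by rewrite -[M in LHS]scale1r reflection_linear scale1r.
case: i => [|[|[|[|[|//]]]]] _ /=; rewrite ?rD ?reflection_delta //.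
- have -> : reflection 1 = 1; last by rewrite inE eqxx.
  by apply/matrixP => k l; rewrite !mxE (inj_eq rev_ord_inj) eq_sym.
- by rewrite addrC; apply: (mem_nth 0 (s := U3_gens) (n := 1)).
- by rewrite addrC; apply: (mem_nth 0 (s := U3_gens) (n := 2)).
- by apply: (mem_nth 0 (s := U3_gens) (n := 4)).
- by apply: (mem_nth 0 (s := U3_gens) (n := 3)).
Qed.

Fact reflection_U3 M : M \in U3_pred -> reflection M \in U3_pred.
Proof.
rewrite /in_mem /= /U3_pred => MU.
have r0 : reflection 0 = 0 by apply/matrixP => i j; rewrite !mxE.
rewrite (coord_span (X := in_tuple U3_gens) MU).
elim/big_rec: _ => [|i N _ NU]; first by rewrite r0 mem0v.
rewrite reflection_linear rpredD // rpredZ //.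
exact/memv_span/reflection_gens.
Qed.

Definition U3_refl (x : U3) : U3 := MkU3 (reflection_U3 (valP x)).

Fact U3_refl_linear c x y : U3_refl (c *: x + y) = c *: U3_refl x + U3_refl y.
Proof. exact/val_inj/reflection_linear. Qed.
Fact U3_reflK x : U3_refl (U3_refl x) = x.
Proof. exact/val_inj/reflectionK. Qed.
Fact U3_reflM x y : U3_refl (x * y) = U3_refl y * U3_refl x.
Proof. exact/val_inj/reflectionM. Qed.

Definition U3_star : starAlg F :=
  trivial_starAlg U3_refl_linear U3_reflK U3_reflM.

End U3.

(* Main.v *)
From HB Require Import structures.
Require Import Defs.
From mathcomp Require Import all_boot all_order all_algebra all_fingroup.
From mathcomp Require Import mxrepresentation ring zify.
From mathcomp Require Import boolp classical_sets reals.
From mathcomp.finmap Require Import -(notations) finmap.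
From mathcomp.multinomials Require Import -(notations) monalg.

(* For f in Id*(A), substitute alpha_v + e j_v for each variable v, with     *)
(* alpha_v a scalar (zero unless v is symmetric of degree 0) and e in F, and *)
(* expand in e: since F is infinite, the parts of degree 0, 1 and 2 vanish   *)
(* separately on A. In U_{3,*} and in the algebras G_2 the augmentation      *)
(* ideal has zero cube, so there f is the sum of these three parts. Taking   *)
(* for j one or two elements of A (and, for type 0+, the unit), [b, c] <> 0  *)
(* with b and c of type t makes the coefficients of degree 2 at variables of *)
(* type t symmetric, and even zero for type 0+; this is all that is needed   *)
(* for f to vanish on the algebra attached to t. Conversely that algebra has *)
(* two noncommuting elements of type t. Finally the proper polynomials in    *)
(* two variables of type t lie in the span of x1 x2 and x2 x1, and the trace *)
(* of the transposition modulo Id*(A) is d - 2 if [x1, x2] is not an         *)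
(* identity and d otherwise, where d is the dimension; so the multiplicity   *)
(* of (1,1) is 1 or 0 accordingly.                                           *)

Set Implicit Arguments.
Unset Strict Implicit.
Unset Printing Implicit Defensive.

Import GRing.Theory Monoid.Theory.

Local Open Scope ring_scope.

(** * Expansion of a substitution by degree *)

(** Every equivalence passes through one condition, [noncommuting A t]: some b, c in A of type t
    satisfy bc <> cb. By [star_id_lie] this says that the commutator of two variables of type t is
    not an identity of A.

    Variety side. The small algebra attached to t is F plus an ideal of zero cube, so the value of f
    at alpha + j is governed by the scalars [poly_coef0], [poly_coef1], [poly_coef2]
    ([evalX_nilpotent]), which involve f and alpha but no algebra. Testing f on A constrains these
    same scalars ([star_id_coef0], [star_id_coef1], [star_id_coef2_sym], [star_id_coef2_sym0]). In
    G_2 the nilpotent parts multiply antisymmetrically and cancel against symmetric coefficients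
    ([G2_evalX_eq0]); in U_3 only products at two variables of type 0+ survive, and their
    coefficients vanish ([U3_in_var]). The converse is [in_var_noncommuting], applied to an explicit
    pair.

    Cocharacter side. On proper polynomials in two variables of type t, the transposition subtracts
    a multiple of the commutator, so modulo the identities it is the identity minus a map of rank at
    most one, whose trace is 2 or 0 ([swap_trace]). Comparison with the characters of S_2
    ([specht_char_2], [specht_char_11]) determines the multiplicity of (1,1), and
    [xget_two_variable] concludes. *)

Section Evaluation.
Variables (F : fieldType) (B : lalgType F) (phi : var -> B).

Definition word_val (w : fmonom var) : B := \prod_(v <- w) phi v.

Lemma evalXE (f : freeAlg F) :
  evalX phi f = \sum_(w <- msupp f) mcoeff w f *: word_val w.
Proof. by rewrite /evalX mmapE; apply: eq_bigr => w _; rewrite mulr_algl. Qed.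

Fact word_val_mmorphism : mmorphism word_val.
Proof.
split=> [w1 w2|]; last by rewrite /word_val fm1 big_nil.
by rewrite /word_val fmM big_cat.
Qed.
HB.instance Definition _ :=
  monalg.isMultiplicative.Build (fmonom var) B word_val word_val_mmorphism.

Lemma evalXB : {morph evalX phi : f g / f - g}.
Proof. exact: (raddfB (mmap (in_alg B) word_val)). Qed.
Lemma evalXD : {morph evalX phi : f g / f + g}.
Proof. exact: (raddfD (mmap (in_alg B) word_val)). Qed.
Lemma evalX0 : evalX phi 0 = 0.
Proof. exact: (raddf0 (mmap (in_alg B) word_val)). Qed.
Lemma evalXZ c f : evalX phi (c *: f) = c *: evalX phi f.
Proof. by rewrite -[RHS]mulr_algl; exact: (@mmapZ _ _ _ (in_alg B) word_val).
  Qed.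
Lemma evalX_fvar v : evalX phi (fvar F v) = phi v.
Proof.
have := @mmapU _ _ _ (in_alg B) word_val 1 (FMonom [:: v]).
by rewrite /word_val big_seq1 /= scale1r mul1r.
Qed.
End Evaluation.

(** Centrality of the scalars is a hypothesis so that the result covers algebras as well as
    evaluation in [freeAlg F] itself, where [malg_mulr_scalar] supplies it. *)
Lemma evalXM_central (F : fieldType) (B : lalgType F) (phi : var -> B) :
  (forall c (x : B), x * c%:A = c *: x) -> {morph evalX phi : f g / f * g}.
Proof.
move=> ZB; apply: (@commr_mmap_is_multiplicative _ _ _ (in_alg B) (word_val
  phi) _).1.
by move=> g m m'; rewrite /= /GRing.comm mulr_algl ZB.
Qed.

Lemma evalXM (F : fieldType) (B : algType F) (phi : var -> B) :
  {morph evalX phi : f g / f * g}.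
Proof. by apply: evalXM_central => c x; rewrite mulr_algr. Qed.

Lemma evalX_lie (F : fieldType) (B : algType F) (phi : var -> B) f g :
  evalX phi (lie f g) = evalX phi f * evalX phi g - evalX phi g * evalX phi f.
Proof. by rewrite /lie evalXB; congr (_ - _); apply: evalXM. Qed.

Lemma evalX_lie_fvar (F : fieldType) (B : algType F) (phi : var -> B) u v :
  evalX phi (lie (fvar F u) (fvar F v)) = phi u * phi v - phi v * phi u.
Proof.
(* Generalizing the variables keeps unification from unfolding products. *)
have fvarE w := evalX_fvar phi w.
by move: (fvarE u) (fvarE v); move: (fvar F u) (fvar F v) => f g <- <-;
  apply: evalX_lie.
Qed.

Section Expansion.
Variables (F : fieldType) (alpha : var -> F).

(** Coefficients in the expansion of the product of the alpha v + j v over w: [word_coef1 x] sums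
    over one occurrence of x, [word_coef2 x y] over an occurrence of x followed later by one of y;
    all other letters contribute their alpha. *)
Fixpoint word_coef0 (w : seq var) : F :=
  if w is v :: w' then alpha v * word_coef0 w' else 1.
Fixpoint word_coef1 (x : var) (w : seq var) : F :=
  if w is v :: w' then (v == x)%:R * word_coef0 w' + alpha v * word_coef1 x w'
  else 0.
Fixpoint word_coef2 (x y : var) (w : seq var) : F :=
  if w is v :: w' then
    (v == x)%:R * word_coef1 y w' + alpha v * word_coef2 x y w'
  else 0.

Variable f : freeAlg F.

Definition poly_vars : seq var :=
  undup (flatten [seq fmonom_val w | w : fmonom var <- msupp f]).
Definition poly_coef0 : F := \sum_(w <- msupp f) mcoeff w f * word_coef0 w.
Definition poly_coef1 x : F := \sum_(w <- msupp f) mcoeff w f * word_coef1 x w.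
Definition poly_coef2 x y : F :=
  \sum_(w <- msupp f) mcoeff w f * word_coef2 x y w.

Variables (B : algType F) (j : var -> B).

Definition poly_part1 : B := \sum_(x <- poly_vars) poly_coef1 x *: j x.
Definition poly_part2 : B :=
  \sum_(x <- poly_vars) \sum_(y <- poly_vars) poly_coef2 x y *: (j x * j y).

(** The product of the alpha v + j v X over w: the indeterminate records the degree in j. *)
Fixpoint word_poly (w : seq var) : {poly B} :=
  if w is v :: w' then (alpha v)%:A *: word_poly w' + (j v)%:P * word_poly w' *
    'X
  else 1.

Lemma horner_word_poly (e : F) (w : seq var) :
  (word_poly w).[e%:A] = \prod_(v <- w) ((alpha v)%:A + e *: j v).
Proof.
elim: w => [|v w IHw] /=; first by rewrite big_nil -polyC1 hornerC.
rewrite big_cons -IHw hornerD hornerZ hornerMX hornerCM mulrDl.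
by rewrite mulr_algr scalerAl.
Qed.

Lemma word_poly_coef0 (w : seq var) : (word_poly w)`_0 = (word_coef0 w)%:A.
Proof.
elim: w => [|v w IHw] /=; first by rewrite coef1 scale1r.
by rewrite coefD coefMX addr0 coefZ IHw mulr_algl scalerA.
Qed.

Lemma sum_eq_var (s : seq var) v (G : var -> B) : uniq s -> v \in s ->
  \sum_(x <- s) (v == x)%:R *: G x = G v.
Proof.
move=> us vs; rewrite (bigD1_seq v) //= eqxx scale1r big1 ?addr0 // => x.
by rewrite eq_sym => /negPf->; rewrite scale0r.
Qed.

Lemma word_poly_coef1 (s w : seq var) : uniq s -> {subset w <= s} ->
  (word_poly w)`_1 = \sum_(x <- s) word_coef1 x w *: j x.
Proof.
move=> us; elim: w => [|v w IHw] sub /=.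
  by rewrite coef1 big1 // => x _; rewrite scale0r.
have sub' : {subset w <= s} by move=> x xw; apply: sub; rewrite inE xw orbT.
rewrite coefD coefMX /= coefZ coefCM word_poly_coef0 IHw // mulr_algr mulr_algl.
rewrite -[in LHS](@sum_eq_var s v j) ?sub ?mem_head //.
rewrite !scaler_sumr -big_split /=; apply: eq_bigr => x _.
by rewrite addrC scalerDl !scalerA mulrC.
Qed.

Lemma word_poly_coef2 (s w : seq var) : uniq s -> {subset w <= s} ->
  (word_poly w)`_2 =
  \sum_(x <- s) \sum_(y <- s) word_coef2 x y w *: (j x * j y).
Proof.
move=> us; elim: w => [|v w IHw] sub /=.
  by rewrite coef1 big1 // => x _; rewrite big1 // => y _; rewrite scale0r.
have sub' : {subset w <= s} by move=> x xw; apply: sub; rewrite inE xw orbT.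
rewrite coefD coefMX /= coefZ coefCM (word_poly_coef1 us) // IHw // mulr_algl.
rewrite -[in LHS](@sum_eq_var s v j) ?sub ?mem_head //.
rewrite mulr_suml scaler_sumr -big_split /=; apply: eq_bigr => x _.
rewrite mulr_sumr scaler_sumr -big_split /=; apply: eq_bigr => y _.
by rewrite addrC scalerDl !scalerA -scalerAl -scalerAr scalerA.
Qed.

Lemma mem_poly_vars (w : fmonom var) : w \in (msupp f : seq (fmonom var)) ->
  {subset (w : seq var) <= poly_vars}.
Proof.
move=> wf x xw; rewrite mem_undup; apply/flattenP.
by exists (w : seq var) => //; apply: map_f.
Qed.

Definition subst_poly : {poly B} :=
  \sum_(w <- msupp f) (mcoeff w f)%:A *: word_poly w.

Lemma horner_subst_poly e :
  subst_poly.[e%:A] = evalX (fun v => (alpha v)%:A + e *: j v) f.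
Proof.
rewrite evalXE horner_sum; apply: eq_bigr => w _.
by rewrite hornerZ horner_word_poly mulr_algl.
Qed.

Lemma subst_poly_coef0 : subst_poly`_0 = poly_coef0%:A.
Proof.
rewrite coef_sum scaler_suml; apply: eq_bigr => w _.
by rewrite coefZ word_poly_coef0 mulr_algl scalerA.
Qed.

Lemma subst_poly_coef1 : subst_poly`_1 = poly_part1.
Proof.
rewrite coef_sum; under eq_bigr do rewrite coefZ mulr_algl.
rewrite /poly_part1; under [RHS]eq_bigr do rewrite scaler_suml.
rewrite exchange_big; apply: eq_big_seq => w wf.
rewrite (word_poly_coef1 (undup_uniq _) (mem_poly_vars wf)) scaler_sumr.
by apply: eq_bigr => x _; rewrite scalerA.
Qed.

Lemma subst_poly_coef2 : subst_poly`_2 = poly_part2.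
Proof.
rewrite coef_sum; under eq_bigr do rewrite coefZ mulr_algl.
rewrite /poly_part2; under [RHS]eq_bigr do
  (under eq_bigr do rewrite scaler_suml; rewrite exchange_big).
rewrite exchange_big; apply: eq_big_seq => w wf /=.
rewrite (word_poly_coef2 (undup_uniq _) (mem_poly_vars wf)) scaler_sumr.
apply: eq_bigr => x _; rewrite scaler_sumr.
by apply: eq_bigr => y _; rewrite scalerA.
Qed.

Lemma evalX_nilpotent : (forall x y z, j x * (j y * j z) = 0) ->
  evalX (fun v => (alpha v)%:A + j v) f = poly_coef0%:A + poly_part1 +
    poly_part2.
Proof.
move=> j3; rewrite -subst_poly_coef0 -subst_poly_coef1 -subst_poly_coef2.
rewrite evalXE !coef_sum -!big_split /=; apply: eq_bigr => w _.
rewrite !coefZ -!mulrDr mulr_algl; congr (_ *: _); rewrite /word_val.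
elim: (w : seq var) => [|v u IHu] /=.
  by rewrite big_nil !coef1 !addr0.
rewrite big_cons IHu !coefD !coefMX /= !coefZ !coefCM mulrDl !mulrDr.
(* One more nilpotent factor kills the part of degree 2. *)
rewrite [j v * (word_poly u)`_2](_ : _ = 0).
  by rewrite !addr0 addrACA -!addrA; congr (_ + _); rewrite addrCA.
rewrite (word_poly_coef2 (undup_uniq u)) => [|x]; last by rewrite mem_undup.
rewrite mulr_sumr big1 // => x _; rewrite mulr_sumr big1 // => y _.
by rewrite -scalerAr j3 scaler0.
Qed.

End Expansion.

(** * Polynomials vanishing at all scalars *)

Section Vanishing.
Variable F : fieldType.
Hypothesis charF : [pchar F]%R =i pred0.

Lemma natF_inj : injective (fun n => n%:R : F).
Proof.
have char0 : forall n, (n%:R == 0 :> F) = (n == 0)%N by apply/pcharf0P.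
suff le m n : (m <= n)%N -> m%:R = n%:R :> F -> m = n.
  by move=> m n mn; case/orP: (leq_total m n) => h; [|apply/esym]; apply: le.
move=> mn /eqP; rewrite eq_sym -subr_eq0 -natrB // char0 subn_eq0 => nm.
by apply/eqP; rewrite eqn_leq mn.
Qed.

Lemma exists_fresh (s : seq F) : exists e, e \notin s.
Proof.
have [/hasP[e _ es]|/hasPn h] :=
    boolP (has (fun e => e \notin s) [seq n%:R | n <- iota 0 (size s).+1]).
  by exists e.
have /uniq_leq_size : uniq [seq n%:R : F | n <- iota 0 (size s).+1].
  by rewrite map_inj_uniq ?iota_uniq //; exact: natF_inj.
move=> /(_ s); rewrite size_map size_iota ltnn => /(_ _)/notF[] //.
by move=> e /h; rewrite negbK.
Qed.

(** B may have zero divisors, so roots cannot simply be counted. Factor out X - e for a scalar root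
    e; at any other scalar e' the value of the second factor is the invertible scalar e' - e, so the
    cofactor vanishes there. The list [s] collects the points used up in this way. *)
Lemma poly_eq0_scalars (B : algType F) (p : {poly B}) :
  (forall e : F, p.[e%:A] = 0) -> p = 0.
Proof.
move=> p0; suff gen n : forall (q : {poly B}) (s : seq F), (size q <= n)%N ->
    (forall e, e \notin s -> q.[e%:A] = 0) -> q = 0.
  by apply: (gen (size p) _ [::]) => // e _; apply: p0.
elim: n => [|n IHn] q s; first by rewrite leqn0 size_poly_eq0 => /eqP.
move=> sq q0; have [e es] := exists_fresh s.
have /factor_theorem[r qr] : root q e%:A by apply/eqP/q0.
case: (eqVneq r 0) qr => [->|r0] qr; first by rewrite qr mul0r.
rewrite qr (IHn r (e :: s)) ?mul0r //.
  by rewrite -ltnS (leq_trans _ sq) // qr size_Mmonic ?monicXsubC // size_XsubC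
    addn2.
move=> e'; rewrite inE negb_or => /andP[ne es'].
have := q0 _ es'; rewrite qr hornerM_comm; last first.
  by rewrite /comm_poly hornerXsubC mulr_algl mulr_algr.
rewrite hornerXsubC -scalerBl mulr_algr => /(congr1 (fun x => (e' - e)^-1 *:
  x)).
by rewrite scalerA mulVf ?subr_eq0 // scale1r scaler0.
Qed.

End Vanishing.

(** * Consequences of an identity *)

Section StarAlgebra.
Variables (F : fieldType) (A : starAlg F).

Lemma homogD i (x y : A) : homog i x -> homog i y -> homog i (x + y).
Proof. by move=> hx hy; rewrite -[x]scale1r; apply: homogP. Qed.

Lemma homogZ i c (x : A) : homog i x -> homog i (c *: x).
Proof. by move=> hx; rewrite -[_ *: _]addr0; apply: homogP => //;
  apply: homog0. Qed.

(** The odd component a1 of the unit kills every homogeneous x, since a1 x = x - a0 x lies in both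
    components; applied to a0 and a1 this gives a1 = 0. *)
Lemma homog_one : homog false (1 : A).
Proof.
have [a0 [a1 [h0 h1 e]]] := homog_decomp (1 : A).
have ann i (x : A) : homog i x -> a1 * x = 0.
  move=> hx; have hx1 : homog (~~ i) (a1 * x) by rewrite -addTb; apply: homogM.
  have hx2 : homog i (a1 * x).
    rewrite (_ : a1 * x = -1 *: (a0 * x) + x).
      by apply: homogP => //; rewrite -[i]addFb; apply: homogM.
    by rewrite scaleN1r -{3}[x]mul1r e mulrDl addKr.
  by case: i hx hx1 hx2 => _ hx1 hx2; apply: homog_direct.
suff a1_0 : a1 = 0 by rewrite e a1_0 addr0.
by rewrite -[a1]mulr1 e mulrDr (ann _ _ h0) (ann _ _ h1) addr0.
Qed.

Lemma star1 : star (1 : A) = 1.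
Proof.
have h : homog false (star (1 : A)) by apply: star_homog; apply: homog_one.
have := starM h homog_one; rewrite mulr1 !starK /= expr0 scale1r mulr1.
exact: esym.
Qed.

Lemma star0 : star (0 : A) = 0.
Proof. by have := star_linear (-1) (0 : A) 0; rewrite !scaleN1r !addNr. Qed.

Lemma starZ c (x : A) : star (c *: x) = c *: star x.
Proof. by rewrite -[c *: x]addr0 star_linear star0 addr0. Qed.

Lemma starD (x y : A) : star (x + y) = star x + star y.
Proof. by rewrite -[x in LHS]scale1r star_linear scale1r. Qed.

Lemma signed0 t : signed_part A t 0.
Proof. by split; [exact: homog0 | rewrite star0 scaler0]. Qed.

Lemma signedD t x y : signed_part A t x -> signed_part A t y ->
  signed_part A t (x + y).
Proof.
move=> [hx sx] [hy sy]; split; first exact: homogD.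
by rewrite starD sx sy scalerDr.
Qed.

Lemma signedZ t c x : signed_part A t x -> signed_part A t (c *: x).
Proof.
move=> [hx sx]; split; first exact: homogZ.
by rewrite starZ sx !scalerA mulrC.
Qed.

Lemma signed_one : signed_part A sym0 1.
Proof. by split; [exact: homog_one | rewrite star1 expr0 scale1r]. Qed.

Definition noncommuting (t : vtype) : Prop := exists b c,
  [/\ signed_part A t b, signed_part A t c & b * c - c * b != 0].

Lemma star_id_lie t :
  star_id A (lie (fvar F (t, 0%N)) (fvar F (t, 1%N))) <-> ~ noncommuting t.
Proof.
have lieE (phi : var -> A) :=
  evalX_lie_fvar phi ((t, 0%N) : var) ((t, 1%N) : var).
split=> [idA [b [c [hb hc /eqP]]]|comm phi hphi]; last first.
  rewrite lieE; apply/eqP/negP => /negP ne; apply: comm.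
  exists (phi (t, 0%N)), (phi (t, 1%N)); split=> //.
    exact: (hphi (t, 0%N)).
  exact: (hphi (t, 1%N)).
apply; pose phi (v : var) := if v == (t, 0%N) then b
  else if v == (t, 1%N) then c else 0.
have /idA : forall v, signed_part A v.1 (phi v).
  move=> v; rewrite /phi; case: eqP => [->//|_]; case: eqP => [->//|_].
  exact: signed0.
by rewrite lieE /phi eqxx; case: eqP => [[]|] //; rewrite eqxx.
Qed.

End StarAlgebra.

Lemma in_var_noncommuting (F : fieldType) (A B : starAlg F) t :
  in_var A B -> noncommuting B t -> noncommuting A t.
Proof.
move=> AB ncB; apply: contrapT => /star_id_lie /AB /star_id_lie; exact.
Qed.

Definition sym0_supported (F : fieldType) (alpha : var -> F) : Prop :=
  forall v, v.1 != sym0 -> alpha v = 0.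

Section Identities.
Variables (F : fieldType) (A : starAlg F).
Hypothesis charF : [pchar F]%R =i pred0.
Variables (f : freeAlg F) (alpha : var -> F).
Hypotheses (fA : star_id A f) (alpha0 : sym0_supported alpha).

Local Notation coef0 := (poly_coef0 alpha f).
Local Notation coef1 := (poly_coef1 alpha f).
Local Notation coef2 := (poly_coef2 alpha f).

(** Each substitution alpha + e j is admissible, because 1 is symmetric of degree 0 and alpha is
    supported on variables of that type. *)
Lemma star_id_subst_poly (j : var -> A) :
  (forall v, signed_part A v.1 (j v)) -> subst_poly alpha f j = 0.
Proof.
move=> hj; apply: (poly_eq0_scalars charF) => e.
rewrite horner_subst_poly; apply: fA => v; apply: signedD; last exact: signedZ.
have [->|/alpha0->] := eqVneq v.1 sym0; last by rewrite scale0r; apply: signed0.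
exact/signedZ/signed_one.
Qed.

Lemma star_id_coef0 : coef0 = 0.
Proof.
have /(congr1 (fun p : {poly A} => p`_0)) :=
  star_id_subst_poly (fun v => @signed0 F A v.1).
by rewrite subst_poly_coef0 poly.coef0 => /eqP;
  rewrite scaler_eq0 oner_eq0 orbF => /eqP.
Qed.

Definition single_var (x : var) (b : A) (v : var) : A := (x == v)%:R *: b.

Lemma signed_single_var (x : var) b :
  signed_part A x.1 b -> forall v, signed_part A v.1 (single_var x b v).
Proof.
move=> hb v; rewrite /single_var; case: eqP => [<-|_]; first exact: signedZ.
by rewrite scale0r; apply: signed0.
Qed.

Lemma star_id_coef1 x b : x \in poly_vars f -> signed_part A x.1 b ->
  b != 0 -> coef1 x = 0.
Proof.
move=> xf hb b0.
have /(congr1 (fun p : {poly A} => p`_1)) :=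
  star_id_subst_poly (signed_single_var hb).
rewrite subst_poly_coef1 poly.coef0 /poly_part1 /single_var.
under eq_bigr do rewrite scalerA mulrC -scalerA.
rewrite (sum_eq_var (fun y => coef1 y *: b)) ?undup_uniq //.
by move/eqP; rewrite scaler_eq0 (negPf b0) orbF => /eqP.
Qed.

(** Polarization: the part of degree 2 is a quadratic form in j. It vanishes at j, at k and at j +
    k, where j is b at x and k is c at y, so the cross terms sum to zero. *)
Lemma star_id_coef2 x y b c : x \in poly_vars f -> y \in poly_vars f ->
  signed_part A x.1 b -> signed_part A y.1 c ->
  coef2 x y *: (b * c) + coef2 y x *: (c * b) = 0.
Proof.
move=> xf yf hb hc.
have part2_0 j : (forall v, signed_part A v.1 (j v)) -> poly_part2 alpha f j =
  0.
  by move=> hj; rewrite -subst_poly_coef2 star_id_subst_poly // poly.coef0.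
pose j := single_var x b; pose k := single_var y c.
have hj := signed_single_var hb; have hk := signed_single_var hc.
pose cross (j k : var -> A) := \sum_(x <- poly_vars f)
  \sum_(y <- poly_vars f) coef2 x y *: (j x * k y).
have crossE x' y' b' c' : x' \in poly_vars f -> y' \in poly_vars f ->
    cross (single_var x' b') (single_var y' c') = coef2 x' y' *: (b' * c').
  move=> xf' yf'; rewrite /cross /single_var.
  have <- := sum_eq_var (fun z => coef2 z y' *: (b' * c')) (undup_uniq _) xf'.
  apply: eq_bigr => z _.
  have <- := sum_eq_var (fun w => coef2 z w *: (b' * c')) (undup_uniq _) yf'.
  rewrite scaler_sumr; apply: eq_bigr => w _.
  by rewrite -scalerAl -scalerAr !scalerA; congr (_ *: _); ring.
have := part2_0 (fun v => j v + k v) (fun v => signedD (hj v) (hk v)).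
rewrite /poly_part2 (_ : \sum_(_ <- _) _ = (cross j j + cross j k)
   + (cross k j + cross k k)).
  by rewrite !crossE // => h; move: (part2_0 _ hj) (part2_0 _ hk);
    rewrite /poly_part2 -/(cross j j) -/(cross k k) !crossE // => e1 e2;
    move: h; rewrite e1 e2 add0r addr0.
rewrite -!big_split; apply: eq_bigr => z _ /=.
rewrite -!big_split; apply: eq_bigr => w _ /=.
by rewrite -!scalerDr mulrDl !mulrDr.
Qed.

(** Exchanging b and c in [star_id_coef2] and subtracting leaves the difference of the two
    coefficients times bc - cb. *)
Lemma star_id_coef2_sym t x y : noncommuting A t ->
  x \in poly_vars f -> y \in poly_vars f -> x.1 = t -> y.1 = t ->
  coef2 x y = coef2 y x.
Proof.
move=> [b [c [hb hc bc]]] xf yf xt yt; rewrite -xt in hb hc.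
have hb' := hb; have hc' := hc; rewrite xt -yt in hb' hc'.
have := star_id_coef2 xf yf hb hc'; have := star_id_coef2 xf yf hc hb'.
move=> e1 e2; have : (coef2 x y - coef2 y x) *: (b * c - c * b) = 0.
  by rewrite scalerBl !scalerBr opprB addrACA e2 -opprD e1 oppr0 addr0.
by move/eqP; rewrite scaler_eq0 (negPf bc) orbF subr_eq0 => /eqP.
Qed.

(** Substituting 1 for both variables shows that the two coefficients are opposite; they are also
    equal, hence zero. *)
Lemma star_id_coef2_sym0 x y : noncommuting A sym0 ->
  x \in poly_vars f -> y \in poly_vars f -> x.1 = sym0 -> y.1 = sym0 ->
  coef2 x y = 0.
Proof.
move=> nc xf yf x0 y0; have one := signed_one A.
have := @star_id_coef2 x y 1 1 xf yf; rewrite x0 y0 => /(_ one one).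
rewrite -(star_id_coef2_sym nc xf yf x0 y0) -scalerDr => /eqP.
rewrite scaler_eq0 mulr1 -(natrD A 1 1) -scaler_nat scaler_eq0 oner_eq0 orbF.
by have/pcharf0P-> := charF; rewrite orbF => /eqP.
Qed.

End Identities.

(** * The Grassmann algebras *)

Section CharZero.
Variable F : fieldType.
Hypothesis charF : [pchar F]%R =i pred0.

Lemma two_neq0 : 2%:R != 0 :> F.
Proof. by have/pcharf0P-> := charF. Qed.

Lemma eq_oppr_eq0 (L : lmodType F) (x : L) : x = - x -> x = 0.
Proof.
move=> /eqP; rewrite -addr_eq0 -mulr2n -scaler_nat scaler_eq0 (negPf two_neq0).
by move/eqP.
Qed.

Section Grassmann.
Variable A : starAlg F.
Local Notation G2 := (G2 F).
Let G2E := (@G2_coefD F, @G2_coefZ F, @G2_coef0 F, @G2_coefE F).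

Lemma G2_mulE (x y : G2) : x * y =
  G2_mk (G2_coef x 0 * G2_coef y 0)
    (G2_coef x 0 * G2_coef y 1 + G2_coef x 1 * G2_coef y 0)
    (G2_coef x 0 * G2_coef y 2 + G2_coef x 2 * G2_coef y 0)
    (G2_coef x 0 * G2_coef y 3 + G2_coef x 1 * G2_coef y 2
     - G2_coef x 2 * G2_coef y 1 + G2_coef x 3 * G2_coef y 0).
Proof. by []. Qed.

(** The conditions on [phi] are what the three structures on G_2 share: a scalar part only at type
    0+, and e_1, e_2 only at type t. Antisymmetric products against symmetric coefficients make the
    part of degree 2 its own negative. *)
Lemma G2_evalX_eq0 t f (phi : var -> G2) : noncommuting A t -> star_id A f ->
  (forall v, v.1 != sym0 -> G2_coef (phi v) 0 = 0) ->
  (forall v, v.1 != t -> G2_coef (phi v) 1 = 0 /\ G2_coef (phi v) 2 = 0) ->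
  (forall v, v.1 != t -> v.1 != sym0 -> phi v = 0) ->
  evalX phi f = 0.
Proof.
move=> nc fA phi0 phi12 phi_t.
pose alpha v := G2_coef (phi v) 0; pose j v := phi v - (alpha v)%:A.
have alpha0 : sym0_supported alpha by [].
have j0 v : G2_coef (j v) 0 = 0.
  by rewrite /j -scaleN1r !G2E //= mulr1 mulN1r subrr.
have ji v i : (0 < i < 4)%N -> G2_coef (j v) i = G2_coef (phi v) i.
  case/andP=> i0 i4; rewrite /j -scaleN1r !G2E //.
  by case: i i0 i4 => [|[|[|[|]]]] //= _ _; rewrite !mulr0 addr0.
have jM x y : j x * j y = G2_mk 0 0 0
    (G2_coef (phi x) 1 * G2_coef (phi y) 2 - G2_coef (phi x) 2 * G2_coef (phi
      y) 1).
  by rewrite G2_mulE !j0 !ji // !(mul0r, mulr0, addr0, add0r).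
have [b [c [hb _ bc]]] := nc.
have b0 : b != 0 by apply: contraNneq bc => ->; rewrite mul0r mulr0 subrr.
rewrite [phi](_ : _ = fun v => (alpha v)%:A + j v); last first.
  by apply: functional_extensionality_dep => v; rewrite /j addrC subrK.
rewrite evalX_nilpotent; last first.
  move=> x y z; rewrite jM G2_mulE !j0; apply: G2P;
    by rewrite !G2E //= !(mul0r, mulr0, addr0, subr0).
rewrite (star_id_coef0 charF fA) // scale0r add0r.
rewrite /poly_part1 big1_seq ?add0r => [|x /andP[_ xf]]; last first.
  have [xt|xt] := eqVneq x.1 t.
    by rewrite (star_id_coef1 charF fA _ xf _ b0) ?xt // scale0r.
  have [x0|x0] := eqVneq x.1 sym0.
    rewrite (star_id_coef1 charF fA _ xf _ (oner_neq0 A)) ?scale0r //.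
    by rewrite x0; apply: signed_one.
  by rewrite /j /alpha phi_t // G2E scale0r subr0 scaler0.
(* Exchanging the sums compares the term at (x, y) with the one at (y, x). *)
apply: eq_oppr_eq0; rewrite {1}/poly_part2 exchange_big -sumrN.
apply: eq_big_seq => x xf; rewrite -sumrN; apply: eq_big_seq => y yf.
have [xt|xt] := eqVneq x.1 t; last first.
  have [x1 x2] := phi12 x xt; rewrite !jM x1 x2 -scalerN -scaleN1r.
  by apply: G2P; rewrite !G2E //= !(mul0r, mulr0, addr0, subr0).
have [yt|yt] := eqVneq y.1 t; last first.
  have [y1 y2] := phi12 y yt; rewrite !jM y1 y2 -scalerN -scaleN1r.
  by apply: G2P; rewrite !G2E //= !(mul0r, mulr0, addr0, subr0).
rewrite (star_id_coef2_sym charF fA alpha0 nc yf xf yt xt) -scalerN;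
  congr (_ *: _).
by rewrite !jM -scaleN1r; apply: G2P; rewrite !G2E //=; ring.
Qed.

Lemma G2_noncommuting :
  (G2_mk 0 1 0 0 : G2) * G2_mk 0 0 1 0 - G2_mk 0 0 1 0 * G2_mk 0 1 0 0 != 0 :>
    G2.
Proof.
rewrite !G2_mulE; apply/eqP => /(congr1 (fun x : G2 => G2_coef x 3)).
rewrite -scaleN1r !G2E //= !(mul0r, mulr0, addr0, add0r, subr0, sub0r, mulr1).
by rewrite mulrN1 opprK => /eqP; rewrite -(natrD F 1 1) (negPf two_neq0).
Qed.

Lemma G2_star_coef s u e (x : G2) : G2_star s u x = (-1) ^+ e *: x ->
  [/\ G2_coef x 0 = (-1) ^+ e * G2_coef x 0,
      s * G2_coef x 1 = (-1) ^+ e * G2_coef x 1,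
      s * G2_coef x 2 = (-1) ^+ e * G2_coef x 2
    & u * G2_coef x 3 = (-1) ^+ e * G2_coef x 3].
Proof.
move=> E; have C i := congr1 (fun y : G2 => G2_coef y i) E.
by split; [have := C 0%N|have := C 1%N|have := C 2%N|have := C 3%N];
  rewrite /= !G2E.
Qed.

Lemma eq_mulN1_eq0 (c : F) : -1 * c = c -> c = 0.
Proof. by rewrite mulN1r => h; apply: (@eq_oppr_eq0 F^o); rewrite [RHS]h. Qed.

Lemma G2_tau_in_var : noncommuting A skew0 <-> in_var A (G2_tau F).
Proof.
split=> [nc f fA phi hphi|inA]; last first.
  apply: in_var_noncommuting inA _.
  exists (G2_mk 0 1 0 0), (G2_mk 0 0 1 0); split; last exact: G2_noncommuting.
    by split=> //; apply: G2P; rewrite /= !G2E //=; ring.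
  by split=> //; apply: G2P; rewrite /= !G2E //=; ring.
have sgn (v : var) : v.1.1 = false -> [/\ v.1.2 -> G2_coef (phi v) 0 = 0,
    ~~ v.1.2 -> G2_coef (phi v) 1 = 0 & ~~ v.1.2 -> G2_coef (phi v) 2 = 0].
  move=> _; have [_ /G2_star_coef[h0 h1 h2 _]] := hphi v.
  by case: v.1.2 h0 h1 h2; rewrite ?expr0 ?expr1 ?mul1r => h0 h1 h2; split=> //;
    move=> _; apply: eq_mulN1_eq0; first [exact: h1 | exact: h2 | exact: esym
      h0].
have odd (v : var) : v.1.1 -> phi v = 0 by have [] := hphi v; case: v.1.1.
apply: (G2_evalX_eq0 nc fA).
- move=> v; have := sgn v; have := odd v; case: v => -[[] []] n //= o s _.
    by rewrite o ?G2E.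
    by rewrite o ?G2E.
  by case: s => // ->.
- move=> v; have := sgn v; have := odd v; case: v => -[[] []] n //= o s _.
    by rewrite o ?G2E.
    by rewrite o ?G2E.
  by case: s => // _ -> // ->.
- by move=> v; have := odd v; case: v => -[[] []] n //= o _ _; apply: o.
Qed.

(** [e] tells whether e_1 and e_2 are symmetric (psi) or skew (tau), so one argument serves both. *)
Lemma G2_gr_in_var (s : F) (ss : s ^+ 2 = 1) (e : bool) : s = (-1) ^+ e ->
  noncommuting A (true, e) <-> in_var A (G2_gr ss).
Proof.
move=> se; split=> [nc f fA phi hphi|inA]; last first.
  apply: in_var_noncommuting inA _.
  exists (G2_mk 0 1 0 0), (G2_mk 0 0 1 0); split; last exact: G2_noncommuting.
    by split; [apply/G2_homogE; rewrite !G2E|rewrite -se; apply: G2P;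
      rewrite /= !G2E //=; ring].
  by split; [apply/G2_homogE; rewrite !G2E|rewrite -se; apply: G2P;
    rewrite /= !G2E //=; ring].
have hom (v : var) : if v.1.1 then G2_coef (phi v) 0 = 0 /\ G2_coef (phi v) 3 =
  0
    else G2_coef (phi v) 1 = 0 /\ G2_coef (phi v) 2 = 0.
  by have [/G2_homogE] := hphi v.
have sgn (v : var) : [/\ v.1.2 -> G2_coef (phi v) 0 = 0,
  v.1.2 -> G2_coef (phi v) 3 = 0,
    e != v.1.2 -> G2_coef (phi v) 1 = 0 & e != v.1.2 -> G2_coef (phi v) 2 = 0].
  have [_ /G2_star_coef[h0 h1 h2 h3]] := hphi v.
  by move: se h0 h1 h2 h3; case: v.1.2; case: (e); rewrite ?expr0 ?expr1 => ->;
    rewrite ?mul1r => h0 h1 h2 h3; split=> //;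
    move=> _; apply: eq_mulN1_eq0; first [exact: h1 | exact: h2 | exact: esym
      h0 | exact: esym h1 | exact: esym h2 | exact: esym h3].
apply: (G2_evalX_eq0 nc fA).
- move=> v; have := sgn v; have := hom v; case: v => -[[] [|]] n //= [h0 h3]
  [s0 _ _ _] _ //; exact: s0.
- move=> v; have := sgn v; have := hom v; case: v => -[[] b] n //= h [_ _ s1
  s2] ne.
  have eb : e != b by apply: contraNneq ne => ->.
  by rewrite s1 ?s2.
- move=> v; have := sgn v; have := hom v; case: v => -[[] b] n //= [h0 h3] [s0
  s3 s1 s2] ne ne'.
    have eb : e != b by apply: contraNneq ne => ->.
    by apply: G2P; rewrite G2E ?h0 ?h3 ?s1 ?s2.
  have eb : b by move: (b) ne' => -[].
  by apply: G2P; rewrite G2E ?h0 ?h3 ?s0 ?s3.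
Qed.

Lemma G2_gr_psi_in_var : noncommuting A sym1 <-> in_var A (G2_gr_psi F).
Proof. exact: G2_gr_in_var. Qed.

Lemma G2_gr_tau_in_var : noncommuting A skew1 <-> in_var A (G2_gr_tau F).
Proof. exact: G2_gr_in_var. Qed.

End Grassmann.
End CharZero.

(** * The algebra U_3 *)

(** Turns a noncommuting symmetric pair into a nonzero skew element of degree 0, which forces the
    linear coefficients at skew variables to vanish in [U3_in_var]. *)
Lemma lie_sym0_skew0 (F : fieldType) (A : starAlg F) (b c : A) :
  signed_part A sym0 b -> signed_part A sym0 c ->
  signed_part A skew0 (b * c - c * b).
Proof.
rewrite /signed_part /= !expr0 expr1 !scale1r => -[hb sb] [hc sc].
rewrite !scaleN1r -[- (c * b)]scaleN1r; split.
  apply: homogD; first exact: (homogM hb hc).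
  exact/homogZ/(homogM hc hb).
rewrite starD starZ (starM hb hc) (starM hc hb) /= !expr0 !scale1r sb sc.
by rewrite !scaleN1r opprB addrC.
Qed.

Section U3Algebra.
Variable F : fieldType.
Local Notation U3 := (U3 F).

Fact U3_gen_mem (i : 'I_5) : (U3_gens F)`_i \in @U3_pred F.
Proof. exact/memv_span/mem_nth. Qed.

Definition U3_gen (i : 'I_5) : U3 := MkU3 (U3_gen_mem i).

Local Notation u := (U3_gen (@Ordinal 5 1 isT)).
Local Notation v := (U3_gen (@Ordinal 5 2 isT)).
Local Notation p := (U3_gen (@Ordinal 5 3 isT)).
Local Notation q := (U3_gen (@Ordinal 5 4 isT)).

(** Coordinates on the augmentation ideal, with u = e23 + e45, v = e12 + e56, p = e13, q = e46. The
    only nonzero products of these generators are v u = p and u v = q. *)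
Definition U3_nil (b c d e : F) : U3 := b *: u + c *: v + d *: p + e *: q.

Lemma U3_nilD b c d e b' c' d' e' :
  U3_nil b c d e + U3_nil b' c' d' e' =
  U3_nil (b + b') (c + c') (d + d') (e + e').
Proof.
suff comb4D (V : lmodType F) (x y z t : V) :
    b *: x + c *: y + d *: z + e *: t + (b' *: x + c' *: y + d' *: z + e' *: t)
      =
    (b + b') *: x + (c + c') *: y + (d + d') *: z + (e + e') *: t.
  exact: comb4D.
by rewrite !scalerDl; do 3![rewrite addrACA; congr (_ + _)].
Qed.

Lemma U3_decomp (x : U3) : exists a b c d e, x = a%:A + U3_nil b c d e.
Proof.
have := coord_span (X := in_tuple (U3_gens F)) (valP x).
pose a i := coord (in_tuple (U3_gens F)) i (val x).
have -> : \sum_i coord (in_tuple (U3_gens F)) i (val x) *: (in_tuple (U3_gens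
  F))`_i =
   \sum_(i < 5) a i *: (U3_gens F)`_i by [].
rewrite 5!big_ord_recl big_ord0 => xE.
exists (a ord0), (a (@Ordinal 5 1 isT)), (a (@Ordinal 5 2 isT)),
  (a (@Ordinal 5 3 isT)), (a (@Ordinal 5 4 isT)).
apply: val_inj; rewrite xE addr0 /U3_nil /= -!addrA.
by do ![congr (_ + _)]; congr (a _ *: _); apply: val_inj.
Qed.

Lemma U3_gen_mul (i j : 'I_5) : (0 < i)%N -> (0 < j)%N ->
  U3_gen i * U3_gen j =
  if (i == 2 :> nat) && (j == 1 :> nat) then p
  else if (i == 1 :> nat) && (j == 2 :> nat) then q else 0.
Proof.
have mE (a d : 'I_6) b c : (b < 6)%N -> (c < 6)%N ->
    delta_mx a (inord b) * delta_mx (inord c) d = delta_mx a d *+ (b == c)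
    :> 'M[F]_6.
  move=> b6 c6; rewrite -[LHS]/(_ *m _) mul_delta_mx_cond.
  by rewrite -val_eqE /= !inordK.
case: i j => [[|[|[|[|[|//]]]]] ilt] [[|[|[|[|[|//]]]]] jlt] //= _ _;
  apply: val_inj => /=;
  by rewrite ?mulrDl ?mulrDr !mE //= ?mulr0n ?mulr1n ?addr0 ?add0r.
Qed.

Lemma U3_nilM b c d e b' c' d' e' :
  U3_nil b c d e * U3_nil b' c' d' e' = U3_nil 0 0 (c * b') (b * c').
Proof.
rewrite /U3_nil !mulrDl !mulrDr -!scalerAl -!scalerAr !U3_gen_mul //=.
by rewrite !scaler0 !scale0r !(addr0, add0r) !scalerA addrC.
Qed.

Lemma U3_nil3 b c d e b' c' d' e' b'' c'' d'' e'' :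
  U3_nil b c d e * (U3_nil b' c' d' e' * U3_nil b'' c'' d'' e'') = 0.
Proof. by rewrite !U3_nilM !mulr0 /U3_nil !scale0r !addr0. Qed.

Lemma U3_refl_nil b c d e : U3_refl (U3_nil b c d e) = U3_nil b c e d.
Proof.
have rD := @U3_refl_linear F; have r0 : U3_refl (0 : U3) = 0.
  by have := rD (-1) 0 0; rewrite !scaleN1r !addNr.
have rZ (k : F) (x : U3) : U3_refl (k *: x) = k *: U3_refl x.
  by have := rD k x 0; rewrite r0 !addr0.
have rA (x y : U3) : U3_refl (x + y) = U3_refl x + U3_refl y.
  by have := rD 1 x y; rewrite !scale1r.
have mrA (M N : 'M[F]_6) : reflection (M + N) = reflection M + reflection N.
  by have := reflection_linear 1 M N; rewrite !scale1r.
have ru : U3_refl u = u.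
  by apply: val_inj; rewrite /= mrA !reflection_delta //= addrC.
have rv : U3_refl v = v.
  by apply: val_inj; rewrite /= mrA !reflection_delta //= addrC.
have rp : U3_refl p = q by apply: val_inj; rewrite /= !reflection_delta.
have rq : U3_refl q = p by apply: val_inj; rewrite /= !reflection_delta.
by rewrite /U3_nil !rA !rZ ru rv rp rq addrAC.
Qed.

Lemma U3_entries a b c d e : let M := val (a%:A + U3_nil b c d e) in
  [/\ M (inord 0) (inord 0) = a, M (inord 1) (inord 2) = b,
      M (inord 0) (inord 1) = c, M (inord 0) (inord 2) = d
    & M (inord 3) (inord 5) = e].
Proof.
rewrite /=; split; rewrite !mxE -!val_eqE /= !inordK //=;
  by rewrite !(mulr1, mulr0, addr0, add0r).
Qed.

End U3Algebra.

Section U3Variety.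
Variables (F : fieldType) (charF : [pchar F]%R =i pred0) (A : starAlg F).
Local Notation U3 := (U3 F).

(** The reflection fixes 1, u, v and exchanges p and q. Hence in a skew element the coordinates on
    1, u, v equal their negatives, so they vanish. *)
Lemma U3_signed (t : vtype) (x : U3) : signed_part (U3_star F) t x ->
  exists a b c d e, [/\ x = a%:A + U3_nil b c d e, t != sym0 -> a = 0,
    t != sym0 -> b = 0 /\ c = 0 & t.1 -> x = 0].
Proof.
move=> [hx sx]; have [t1|t1] := boolP t.1.
  have x0 : x = 0 by move: hx; rewrite t1.
  exists 0, 0, 0, 0, 0; split=> //.
  by rewrite x0 /U3_nil !scale0r !addr0.
have [a [b [c [d [e xE]]]]] := U3_decomp x; exists a, b, c, d, e.
suff abc0 : t != sym0 -> [/\ a = 0, b = 0 & c = 0].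
  by split=> // /abc0[].
move=> t0; have {sx} sx : U3_refl x = - x.
  by move: sx t1 t0; case: t hx => -[] [] //= _ ->; rewrite expr1 scaleN1r.
have : x + U3_refl x = 0 by rewrite sx subrr.
have -> : U3_refl x = a%:A + U3_nil b c e d.
  rewrite xE; have := U3_refl_linear a 1 (U3_nil b c d e).
  rewrite U3_refl_nil => ->; congr (a *: _ + _); exact: (@star1 F (U3_star F)).
have -> : x + (a%:A + U3_nil b c e d) =
    (a + a)%:A + U3_nil (b + b) (c + c) (d + e) (e + d).
  by rewrite xE addrACA -scalerDl U3_nilD.
move=> h0; have := U3_entries (a + a) (b + b) (c + c) (d + e) (e + d).
rewrite h0 /= !mxE => -[/esym ea /esym eb /esym ec _ _].
have half (z : F) : z + z = 0 -> z = 0.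
  by move/eqP; rewrite addr_eq0 => /eqP/(eq_oppr_eq0 charF (L := F^o)).
by split; apply: half.
Qed.

Lemma U3_in_var : noncommuting A sym0 <-> in_var A (U3_star F).
Proof.
split=> [nc f fA phi hphi|inA]; last first.
  apply: in_var_noncommuting inA _; exists (U3_nil 1 0 0 0), (U3_nil 0 1 0 0).
  split.
  - by split=> //=; rewrite U3_refl_nil scale1r.
  - by split=> //=; rewrite U3_refl_nil scale1r.
  apply/eqP; rewrite !U3_nilM => h.
  (* The commutator is q - p, whose entry at (4, 6), numbered from 1, is 1. *)
  have := U3_entries 0 0 0 (-1 : F) 1; rewrite scale0r add0r.
  rewrite (_ : U3_nil _ _ _ _ = 0) => [|].
    by rewrite /= !mxE => -[_ _ _ _ /esym/eqP]; rewrite oner_eq0.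
  rewrite -h /U3_nil !(scale0r, add0r, addr0, mulr0, mul0r, mulr1, scale1r).
  by rewrite scaleN1r addrC.
have /choice[g hg] (x : var) : exists g : F * U3,
    [/\ phi x = g.1%:A + g.2, exists b c d e, g.2 = U3_nil b c d e,
        x.1 != sym0 -> g.1 = 0,
        x.1 != sym0 -> exists d e, g.2 = U3_nil 0 0 d e
      & x.1.1 -> g.2 = 0].
  have [a [b [c [d [e [xE a0 bc0 odd]]]]]] := U3_signed (hphi x).
  exists (a, U3_nil b c d e); split=> //=.
  - by exists b, c, d, e.
  - by move=> /bc0[-> ->]; exists d, e.
  move=> x1; move: (odd x1); rewrite xE a0; last by case: (x.1) x1 => -[].
  by rewrite scale0r add0r.
have nilE x : exists b c d e, (g x).2 = U3_nil b c d e by have [] := hg x.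
rewrite (_ : phi = fun x => (g x).1%:A + (g x).2); last first.
  by apply: functional_extensionality_dep => x; have [] := hg x.
have alpha0 : sym0_supported (fun x => (g x).1) by move=> x; have [] := hg x.
rewrite evalX_nilpotent; last first.
  move=> x y z; have [? [? [? [? ->]]]] := nilE x.
  have [? [? [? [? ->]]]] := nilE y; have [? [? [? [? ->]]]] := nilE z.
  exact: U3_nil3.
rewrite (star_id_coef0 charF fA) // scale0r add0r.
have [b [c [hb hc bc]]] := nc.
rewrite /poly_part1 big1_seq ?add0r => [|x /andP[_ xf]]; last first.
  have [x0|x0] := eqVneq x.1 sym0.
    rewrite (star_id_coef1 charF fA _ xf _ (oner_neq0 A)) ?scale0r //.
    by rewrite x0; apply: signed_one.
  have [x1|x1] := eqVneq x.1 skew0.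
    rewrite (star_id_coef1 charF fA _ xf _ bc) ?scale0r // x1.
    exact: lie_sym0_skew0.
  have [_ _ _ _ ->] := hg x; rewrite ?scaler0 //.
  by case: (x.1) x0 x1 => -[] [].
rewrite /poly_part2 big1_seq // => x /andP[_ xf].
rewrite big1_seq // => y /andP[_ yf].
(* The nilpotent part at a variable not of type 0+ lies in the span of p and q, which annihilates
   the augmentation ideal. *)
have [x0|x0] := eqVneq x.1 sym0; last first.
  have [_ _ _ /(_ x0)[d [e ->]] _] := hg x.
  have [? [? [? [? ->]]]] := nilE y.
  by rewrite U3_nilM !mul0r /U3_nil !scale0r !addr0 scaler0.
have [y0|y0] := eqVneq y.1 sym0; last first.
  have [_ _ _ /(_ y0)[d [e ->]] _] := hg y.
  have [? [? [? [? ->]]]] := nilE x.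
  by rewrite U3_nilM !mulr0 /U3_nil !scale0r !addr0 scaler0.
by rewrite (star_id_coef2_sym0 charF fA alpha0 nc xf yf x0 y0) scale0r.
Qed.

End U3Variety.

(** * Characters of the symmetric group on two letters *)

Section LinearCharacter.
Variables (F : fieldType) (gT : finGroupType) (G : {group gT}) (chi : gT -> F).

(** The cyclic module generated by a common eigenvector is a line, on which [x] acts by the scalar
    [chi x]. *)
Lemma tr_cyclic_linear n (rG : mx_representation F G n) (u : 'rV_n) x :
  u != 0 -> {in G, forall y, u *m rG y = chi y *: u} -> x \in G ->
  \tr (submod_repr (cyclic_mx_module rG u) x) = chi x.
Proof.
move=> u0 uG Gx; set U := cyclic_mx rG u.
have sub_uU : (u <= U)%MS := cyclic_mx_id rG u.
have sUu : (U <= u)%MS.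
  apply/row_subP => i; have /cyclic_mxP[E EG ->] := row_sub i U.
  have /envelop_mxP[a ->] := EG; rewrite mulmx_sumr; apply: summx_sub => y Gy.
  by rewrite -scalemxAr uG // scalerA scalemx_sub.
have rU : \rank U = 1%N.
  have -> : \rank U = \rank u by apply/eqP; rewrite eqn_leq !mxrankS.
  by rewrite rank_rV u0.
have -> : submod_repr (cyclic_mx_module rG u) x = (chi x)%:M.
  rewrite /= /submod_mx -/U; apply: (can_inj (val_submodK (U := U))).
  have scal : val_submod (chi x)%:M = chi x *: val_submod (1%:M : 'M_(\rank U)).
    by rewrite /val_submod /= -[in LHS]scalemx1 -scalemxAl.
  have modU := cyclic_mx_module rG u.
  have inU : (val_submod (1%:M : 'M_(\rank U)) <= U)%MS by rewrite val_submod1.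
  rewrite in_submodK ?(submx_trans (submxMr _ inU)) ?(mxmoduleP modU) // scal.
  have /submxP[D ->] := submx_trans inU sUu.
  by rewrite -mulmxA uG // -scalemxAr.
by rewrite mxtrace_scalar rU.
Qed.

End LinearCharacter.

Section SpechtTwo.
Variable F : fieldType.

(** The sign character if [e] holds, the trivial character otherwise. *)
Definition sign_if (e : bool) n (s : 'S_n) : F := (-1) ^+ (e && odd_perm s).

Lemma sign_ifM e n (s t : 'S_n) : sign_if e (s * t) = sign_if e s * sign_if e t.
Proof. by case: e; rewrite /sign_if ?mul1r //= odd_permM signr_addb. Qed.

(** A sum over S_n weighted by a linear character is an eigenvector for right multiplication, and is
    nonzero since its coefficient at 1 is 1. The Young symmetrizers of the empty partition, (2) and
    (1,1) have this form. *)
Lemma specht_char_linear (l : seq nat) n e (x : 'S_n) :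
  young_sym F l n = \sum_(s : 'S_n)
     sign_if e s *: delta_mx 0 (gring_index [set: 'S_n]%G s) ->
  specht_char F l x = sign_if e x.
Proof.
move=> yE; apply: (tr_cyclic_linear (chi := @sign_if e n)); rewrite ?inE //.
  apply/eqP => /rowP/(_ (gring_index [set: 'S_n]%G 1%g)); rewrite yE summxE.
  rewrite (bigD1 1%g) //= big1 => [|s s1].
    by rewrite !mxE !eqxx /= addr0 mulr1 /sign_if odd_perm1 andbF => /eqP;
      rewrite oner_eq0.
  rewrite !mxE /= (inj_in_eq (can_in_inj (@gring_indexK _ [set: 'S_n]%G))) ?inE
    //.
  by rewrite eq_sym (negPf s1) mulr0.
move=> y _; rewrite yE mulmx_suml scaler_sumr [RHS](reindex_inj (mulIg y)) /=.
apply: eq_bigr => s _; rewrite -scalemxAl -rowE rowK gring_indexK ?inE //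
  scalerA.
rewrite sign_ifM mulrCA; congr (_ *: _).
by rewrite /sign_if -signr_addb addbb mulr1.
Qed.

Lemma specht_char_nil (x : 'S_0) : specht_char F [::] x = 1.
Proof.
have S0 (s : 'S_0) : s = 1%g by apply/permP => -[].
rewrite (@specht_char_linear _ _ false) //; rewrite /young_sym.
have -> : row_stab [::] 0 = [set 1%g].
  by apply/setP => s; rewrite !inE (S0 s) eqxx; apply/forallP => -[].
have -> : col_stab [::] 0 = [set 1%g].
  by apply/setP => s; rewrite !inE (S0 s) eqxx; apply/forallP => -[].
rewrite !big_set1 (bigD1 1%g) //= big1 ?addr0 => [|s];
  last by rewrite (S0 s) eqxx.
by rewrite /sign_if odd_perm1 mul1g.
Qed.

Lemma specht_char_2 (x : 'S_2) : specht_char F [:: 2%N] x = 1.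
Proof.
rewrite (@specht_char_linear _ _ false) // /young_sym.
have -> : row_stab [:: 2%N] 2 = [set: 'S_2].
  by apply/setP => s; rewrite !inE; apply/forallP => i;
    case: (s i) => [[|[|]]] // ?; case: i => [[|[|]]].
have -> : col_stab [:: 2%N] 2 = [set 1%g].
  apply/setP => s; rewrite !inE; apply/forallP/eqP => [h|-> i];
    last by rewrite perm1.
  apply/permP => i; rewrite perm1; apply/val_inj/eqP; have := h i.
  by case: (s i) => [[|[|]]] // ?; case: i => [[|[|]]].
under eq_bigl do rewrite inE.
by apply: eq_bigr => s _; rewrite big_set1 odd_perm1 mulg1.
Qed.

Lemma specht_char_11 (x : 'S_2) : specht_char F [:: 1%N;
  1%N] x = (-1) ^+ odd_perm x.
Proof.
rewrite (@specht_char_linear _ _ true) // /young_sym.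
have -> : col_stab [:: 1%N; 1%N] 2 = [set: 'S_2].
  by apply/setP => s; rewrite !inE; apply/forallP => i;
    case: (s i) => [[|[|]]] // ?; case: i => [[|[|]]].
have -> : row_stab [:: 1%N; 1%N] 2 = [set 1%g].
  apply/setP => s; rewrite !inE; apply/forallP/eqP => [h|-> i];
    last by rewrite perm1.
  apply/permP => i; rewrite perm1; apply/val_inj/eqP; have := h i.
  by case: (s i) => [[|[|]]] // ?; case: i => [[|[|]]].
rewrite big_set1; under eq_bigl do rewrite inE.
by apply: eq_bigr => s _; rewrite mul1g.
Qed.

Lemma partitions_0 : partitions 0 = [:: [::]].
Proof. by []. Qed.

Lemma partitions_2 : partitions 2 = [:: [:: 2%N]; [:: 1%N; 1%N]].
Proof. by []. Qed.

End SpechtTwo.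

(** * The trace of a swap modulo a subspace *)

Section SwapCharacter.
Variables (F : fieldType) (charF : [pchar F]%R =i pred0) (L : lmodType F).

Definition subspace (W : set L) : Prop :=
  W 0 /\ forall c x y, W x -> W y -> W (c *: x + y).

Lemma subspaceD W x y : subspace W -> W x -> W y -> W (x + y).
Proof. by move=> [_ WP] Wx Wy; rewrite -[x]scale1r; apply: WP. Qed.

Lemma subspaceZ W c x : subspace W -> W x -> W (c *: x).
Proof. by move=> [W0 WP] Wx; rewrite -[_ *: _]addr0; apply: WP. Qed.

Lemma subspaceB W x y : subspace W -> W x -> W y -> W (x - y).
Proof. by move=> sW Wx Wy; rewrite addrC -scaleN1r; apply: sW.2. Qed.

Lemma subspace_sum W n (x : 'I_n -> L) : subspace W -> (forall i, W (x i)) ->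
  W (\sum_i x i).
Proof. by move=> sW Wx; elim/big_ind: _ => // [|y z];
  [exact: sW.1|exact: subspaceD]. Qed.

Lemma lin_span_subspace (S : set L) : subspace (lin_span S).
Proof.
split; first by exists 0%N, (fun=> 0), (fun=> 0); split=> [[]//|];
  rewrite big_ord0.
move=> c x y [k [a [u [Su ->]]]] [k' [a' [u' [Su' ->]]]].
exists (k + k')%N, (fun i => match split i with inl j => c * a j | inr j => a'
  j end),
  (fun i => match split i with inl j => u j | inr j => u' j end).
split=> [i|]; first by case: (split i).
rewrite big_split_ord scaler_sumr /=; congr (_ + _); apply: eq_bigr => i _.
  by rewrite (unsplitK (inl i)) scalerA.
by rewrite (unsplitK (inr i)).
Qed.

Lemma lin_span_gen (S : set L) x : S x -> lin_span S x.
Proof.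
move=> Sx; exists 1%N, (fun=> 1), (fun=> x); split=> //.
by rewrite big_ord1 scale1r.
Qed.

Lemma lin_span_sub (S W : set L) : subspace W -> (forall x, S x -> W x) ->
  forall x, lin_span S x -> W x.
Proof.
move=> sW SW x [k [c [u [Su ->]]]]; apply: subspace_sum => // i.
by apply: subspaceZ sW _; apply: SW; apply: Su.
Qed.

(** Any generator with a nonzero coefficient in a relation modulo W can be discarded. *)
Lemma basis_mod_exists (V W : set L) n (g : 'I_n -> L) : subspace W ->
  (forall i, V (g i)) ->
  (forall v, V v -> exists c : 'I_n -> F, W (v - \sum_i c i *: g i)) ->
  exists d (b : 'I_d -> L), basis_mod V W b.
Proof.
move=> sW; elim: n g => [|n IHn] g Vg gen; first by exists 0%N, g;
  split=> // ? ? [] //.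
have [free|] := pselect (forall c : 'I_n.+1 -> F,
  W (\sum_i c i *: g i) -> forall i, c i = 0).
  by exists n.+1, g.
move=> /existsNP[c /not_implyP[Wc /existsNP[i /eqP ci]]].
apply: (IHn (fun j => g (lift i j))) => // v /gen[a Wa].
exists (fun j => a (lift i j) - a i / c i * c (lift i j)).
rewrite (_ : v - _ = (a i / c i) *: (\sum_i c i *: g i) + (v - \sum_i a i *: g
  i)).
  exact: sW.2.
have -> : \sum_j (a (lift i j) - a i / c i * c (lift i j)) *: g (lift i j) =
    \sum_j a (lift i j) *: g (lift i j)
    - (a i / c i) *: \sum_j c (lift i j) *: g (lift i j).
  rewrite scaler_sumr -sumrB; apply: eq_bigr => j _.
  by rewrite scalerBl scalerA.
rewrite !(bigD1_ord i) //= scalerDr scalerA divfK //.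
by rewrite opprB [RHS]addrCA opprD addrACA subrr add0r.
Qed.

Variables (V W : set L) (X Y : L) (P : bool -> L -> L).
Local Notation comb l m := (l *: X + m *: Y).
Hypotheses (sV : subspace V) (sW : subspace W).
Hypothesis V_comb : forall v, V v -> exists l m, v = comb l m.
Hypothesis V_diff : V (X - Y).
Hypothesis W_swap : forall l m, W (comb l m) -> W (comb m l).
Hypothesis P_comb : forall e l m, P e (comb l m) = if e then comb m l else comb
  l m.

(** Abstract form of a proper cocharacter for S_2: [c2] and [c11] are the multiplicities of the
    trivial and the sign character. *)
Definition swap_character (c2 c11 : nat) : Prop :=
  exists d (b : 'I_d -> L), basis_mod V W b /\
    forall e (M : 'M[F]_d), (forall i, W (P e (b i) - \sum_j M i j *: b j)) ->
      \tr M = c2%:R + c11%:R * (-1) ^+ (e : bool).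

Lemma basis_mod_unique d (b : 'I_d -> L) v c c' : basis_mod V W b ->
  W (v - \sum_i c i *: b i) -> W (v - \sum_i c' i *: b i) -> c =1 c'.
Proof.
move=> [_ free _] Wc Wc' i; apply/eqP; rewrite -subr_eq0; apply/eqP.
apply: (free (fun i => c i - c' i)).
under eq_bigr do rewrite scalerBl.
rewrite sumrB; have := subspaceB sW Wc' Wc.
by rewrite opprB addrC addrA subrK.
Qed.

(** The swap sends b_i = l X + m Y to b_i - k_i (X - Y) with k_i = l - m. If X - Y is the sum of the
    c_i b_i modulo W, the trace is d minus the sum of the c_i k_i, and that sum is 2 unless X - Y
    lies in W, where it is 0. *)
Lemma swap_trace d (b : 'I_d -> L) : basis_mod V W b ->
  exists M : bool -> 'M[F]_d, [/\
    forall e i, W (P e (b i) - \sum_j M e i j *: b j),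
    \tr (M false) = d%:R
    & \tr (M true) = d%:R - 2 * (~~ `[< W (X - Y) >])%:R].
Proof.
move=> bB; have [Vb free gen] := bB.
have /choice[lm lmE] i : exists lm : F * F, b i = comb lm.1 lm.2.
  by have [l [m ->]] := V_comb (Vb i); exists (l, m).
have [c Wc] := gen _ V_diff.
pose k i := (lm i).1 - (lm i).2.
pose M (e : bool) : 'M[F]_d :=
  \matrix_(i, j) ((i == j)%:R - (if e then k i else 0) * c j).
have ME e i : \sum_j M e i j *: b j =
    b i - (if e then k i else 0) *: \sum_j c j *: b j.
  under eq_bigr do rewrite mxE scalerBl -scalerA.
  rewrite sumrB -scaler_sumr; congr (_ - _).
  rewrite (bigD1 i) //= eqxx scale1r big1 ?addr0 // => j ji.
  by rewrite eq_sym (negPf ji) scale0r.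
have PE e i : P e (b i) = b i - (if e then k i else 0) *: (X - Y).
  rewrite lmE P_comb; case: e; last by rewrite scale0r subr0.
  rewrite /k -scaleNr opprB scalerBr -[- (_ *: Y)]scaleNr opprB addrACA.
  by rewrite -!scalerDl !subrKC.
exists M; split.
- move=> e i; rewrite ME PE opprD opprK addrACA subrr add0r addrC.
  rewrite -scalerBr -opprB scalerN -scaleNr.
  exact: subspaceZ.
- rewrite /mxtrace; under eq_bigr do rewrite mxE eqxx mul0r subr0.
  by rewrite sumr_const card_ord.
have -> : \tr (M true) = d%:R - \sum_i c i * k i.
  rewrite /mxtrace; under eq_bigr do rewrite mxE eqxx mulrC.
  by rewrite sumrB sumr_const card_ord.
congr (_ - _); have [WXY|nW] /= := asboolP (W (X - Y)).
  rewrite mulr0 big1 // => i _; rewrite free ?mul0r //.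
  have := subspaceB sW WXY Wc; by rewrite opprB addrC subrK.
rewrite mulr1; pose l := \sum_i c i * (lm i).1; pose m := \sum_i c i * (lm i).2.
have cE : \sum_i c i *: b i = comb l m.
  under eq_bigr do rewrite lmE scalerDr !scalerA.
  by rewrite big_split -!scaler_suml.
have -> : \sum_i c i * k i = l - m.
  by under eq_bigr do rewrite mulrBr; rewrite sumrB.
(* The k_i depend on chosen coordinates, as X and Y may be dependent modulo W; stability of W under
   the swap settles the sum. Subtracting from this element its swap gives (2 - (l - m))(X - Y) in W,
   which forces l - m = 2. *)
have W1 : W (comb (1 - l) (-1 - m)).
  by move: Wc; rewrite cE !scalerBl scale1r scaleN1r opprD addrACA.
have := subspaceB sW W1 (W_swap W1).
rewrite opprD addrACA -!scalerBl (_ : _ - _ = 2 - (l - m)); last by ring.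
rewrite (_ : -1 - m - _ = - (2 - (l - m))); last by ring.
rewrite scaleNr -scalerBr => W2; apply/eqP; rewrite eq_sym -subr_eq0; apply/eqP.
have [//|/eqP ne0] := pselect (2 - (l - m) = 0); case: nW.
by have := subspaceZ (2 - (l - m))^-1 sW W2; rewrite scalerA mulVf // scale1r.
Qed.

(** The traces d = c2 + c11 and d - 2n = c2 - c11, with n = 0 or 1, determine c11 independently of
    the basis and of the decomposition. *)
Lemma swap_character_values d (b : 'I_d -> L) c2 c11 : basis_mod V W b ->
  (forall e (M : 'M[F]_d), (forall i, W (P e (b i) - \sum_j M i j *: b j)) ->
      \tr M = c2%:R + c11%:R * (-1) ^+ (e : bool)) ->
  c11 = nat_of_bool (~~ `[< W (X - Y) >]).
Proof.
move=> bB tr; have [M [WM M0 M1]] := swap_trace bB.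
have := tr _ _ (WM true); have := tr _ _ (WM false).
rewrite M0 M1 expr0 expr1 mulr1 mulrN1; set n := (~~ _)%:R.
move=> -> h; apply: (natF_inj charF).
have : (2 : F) * (c11%:R - n) = 0.
  by rewrite -(subrr (c2%:R - c11%:R)) -{1}h; ring.
by move/eqP; rewrite mulf_eq0 (negPf (two_neq0 charF)) /= subr_eq0 => /eqP->.
Qed.

Lemma swap_character_exists : ~ W (X - Y) -> exists c2, swap_character c2 1.
Proof.
move=> nW; have [d [b bB]] : exists d (b : 'I_d -> L), basis_mod V W b.
  (* Both cases occur: for type 0+ the proper polynomials form the line through the commutator, for
     the other types both monomials are proper. *)
  have [VX|nVX] := pselect (V X).
    apply: (@basis_mod_exists V W 2 (fun i => if i == ord0 then X else Y)) =>
      //.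
      move=> i; case: eqP => // _; rewrite -(subKr X Y).
      exact: subspaceB.
    move=> v /V_comb[l [m ->]]; exists (fun i => if i == ord0 then l else m).
    by rewrite big_ord_recl big_ord1 /= subrr; exact: sW.1.
  apply: (@basis_mod_exists V W 1 (fun=> X - Y)) => // v Vv.
  have [l [m vE]] := V_comb Vv; exists (fun=> l); rewrite big_ord1.
  have : l + m = 0.
    have [//|/eqP lm0] := pselect (l + m = 0); case: nVX.
    have -> : X = (l + m)^-1 *: (v + m *: (X - Y)).
      rewrite vE scalerBr addrACA subrr addr0 -scalerDl scalerA mulVf //.
      by rewrite scale1r.
    by apply: subspaceZ => //; apply: subspaceD => //; apply: subspaceZ.
  move=> lm; rewrite vE scalerBr opprB [_ *: Y - _]addrC addrACA subrr add0r.
  by rewrite -scalerDl addrC lm scale0r; exact: sW.1.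
(* One sign character, the rest trivial; d > 0 because X - Y is nonzero modulo W. *)
exists d.-1, d, b; split=> // e M WM.
have [M' [WM' M0 M1]] := swap_trace bB.
have -> : M = M' e.
  apply/matrixP => i j; exact: basis_mod_unique bB (WM i) (WM' e i) j.
have d0 : (0 < d)%N.
  rewrite lt0n; apply/eqP => d0; apply: nW; have [_ _ /(_ _ V_diff)[c]] := bB.
  by rewrite big1 ?subr0 // => i _; have := ltn_ord i; rewrite {2}d0.
have dE : d%:R = d.-1%:R + 1 :> F by rewrite -{1}(prednK d0) -addn1 natrD.
case: e {WM}; last by rewrite M0 dE expr0 mulr1.
by rewrite M1 dE (asboolF nW) expr1 /=; ring.
Qed.

Lemma swap_character_eq1 c2 c11 : swap_character c2 c11 ->
  c11 = 1%N <-> ~ W (X - Y).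
Proof.
move=> [d [b [bB tr]]]; rewrite (swap_character_values bB tr).
by split=> [|nW]; [case: asboolP | rewrite asboolF].
Qed.

End SwapCharacter.

(** * Proper polynomials in two variables *)

Lemma malg_mulr_scalar (F : fieldType) (f : freeAlg F) c : f * c%:A = c *: f.
Proof.
have -> : c%:A = mkmalgU (monalg.one : fmonom var) c :> freeAlg F by rewrite
  -mul_malgC mulr1.
rewrite -mul_malgC [LHS](@fgmulgU _ _ c monalg.one f) [RHS](@fgmulUg _ _ c
  monalg.one f).
by apply: eq_bigr => w _; rewrite mulrC mul1m mulm1.
Qed.

Section TwoVariables.
Variables (F : fieldType) (t : vtype).

Local Notation x0 := ((t, 0%N) : var).
Local Notation x1 := ((t, 1%N) : var).

Definition comb2 (L : lalgType F) (a b : L) (l m : F) : L :=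
  l *: (a * b) + m *: (b * a).

Lemma comb2C (L : lalgType F) (a b : L) l m : comb2 a b l m = comb2 b a m l.
Proof. exact: addrC. Qed.

Lemma comb2_10 (L : lalgType F) (a b : L) : comb2 a b 1 0 = a * b.
Proof. by rewrite /comb2 scale1r scale0r addr0. Qed.

Lemma comb2_lie (L : lalgType F) (a b : L) : comb2 a b 1 (-1) = a * b - b * a.
Proof. by rewrite /comb2 scale1r scaleN1r. Qed.

Lemma comb2_subspace (L : lalgType F) (a b : L) :
  subspace (fun f => exists l m, f = comb2 a b l m).
Proof.
split; first by exists 0, 0; rewrite /comb2 !scale0r addr0.
move=> c _ _ [l [m ->]] [l' [m' ->]]; exists (c * l + l'), (c * m + m').
by rewrite /comb2 !scalerDl scalerDr !scalerA addrACA.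
Qed.

Lemma evalX_comb2 (B : lalgType F) (phi : var -> B) f g l m :
  (forall c (x : B), x * c%:A = c *: x) ->
  evalX phi (comb2 f g l m) = comb2 (evalX phi f) (evalX phi g) l m.
Proof.
move=> ZB; rewrite /comb2 evalXD.
by congr (_ + _); rewrite evalXZ (evalXM_central phi ZB).
Qed.

Lemma star_id_subspace (A : starAlg F) : subspace (star_id A).
Proof.
split=> [phi _|c f g fA gA phi hphi]; first exact: evalX0.
by rewrite evalXD evalXZ fA // gA // scaler0 addr0.
Qed.

Lemma star_id_swap (A : starAlg F) l m :
  star_id A (comb2 (fvar F x0) (fvar F x1) l m) ->
  star_id A (comb2 (fvar F x0) (fvar F x1) m l).
Proof.
have e0 (phi : var -> A) := evalX_fvar phi x0.
have e1 (phi : var -> A) := evalX_fvar phi x1.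
move: (fvar F x0) (fvar F x1) e0 e1 => a b e0 e1 idA phi hphi.
pose psi (v : var) := if v == x0 then phi x1 else if v == x1 then phi x0 else
  phi v.
have ZA c (x : A) : x * c%:A = c *: x by rewrite mulr_algr.
have /idA : forall v, signed_part A v.1 (psi v).
  move=> v; rewrite /psi; case: eqP => [->|_]; first exact: (hphi x1).
  by case: eqP => [->|_]; [exact: (hphi x0)|exact: hphi].
rewrite !evalX_comb2 // !e0 !e1 comb2C /psi eqxx.
by rewrite (_ : (x1 == x0) = false) ?eqxx //; apply/eqP => -[].
Qed.

Lemma perm_eq_pair (T : eqType) (a b : T) s :
  perm_eq s [:: a; b] -> s = [:: a; b] \/ s = [:: b; a].
Proof.
move=> ps; have := perm_size ps.
case: s ps => [|c [|d []]] // ps _.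
have : c \in [:: a; b] by rewrite -(perm_mem ps) mem_head.
rewrite !inE => /orP[/eqP ca|/eqP cb]; rewrite ?ca ?cb in ps *.
  left; move: ps; rewrite perm_cons => /perm_mem/(_ d).
  by rewrite mem_head inE => /esym/eqP->.
right; move: ps; rewrite perm_sym -cat1s perm_catC perm_cons => /perm_mem/(_ a).
by rewrite mem_head inE => /esym/eqP->.
Qed.

Variables n1 n2 n3 n4 : nat.
Hypothesis varsE : proper_vars n1 n2 n3 n4 = [:: x0; x1].

(** A commutator uses at least two letters, so a generator is either a product of the two variables
    or a single commutator of them. *)
Lemma proper_polys_comb2 f : proper_polys F n1 n2 n3 n4 f ->
  exists l m, f = comb2 (fvar F x0) (fvar F x1) l m.
Proof.
apply: (lin_span_sub (comb2_subspace (fvar F x0) (fvar F x1))).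
move=> _ [ys [zs [ws [cs [_ szcs ps ->]]]]]; rewrite varsE in ps.
pose s := ys ++ zs ++ ws.
have prod_cat3 (L : lalgType F) (h : var -> L) :
    \prod_(v <- ys) h v * \prod_(v <- zs) h v * \prod_(v <- ws) h v =
    \prod_(v <- s) h v.
  by rewrite !big_cat /= mulrA.
suff [l [m E]] : exists l m, \prod_(v <- s) fvar F v * \prod_(c <- cs) lcomm F
  c =
    comb2 (fvar F x0) (fvar F x1) l m.
  by exists l, m; rewrite -E; congr (_ * _); exact: prod_cat3.
have {}ps : perm_eq (s ++ flatten cs) [:: x0; x1] by rewrite /s -!catA.
case: cs szcs ps => [_|c cs /= /andP[szc szcs]].
  rewrite cats0 big_nil mulr1 => /perm_eq_pair[] ->; rewrite big_cons big_seq1.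
    by exists 1, 0; rewrite comb2_10.
  by exists 0, 1; rewrite comb2C comb2_10.
move=> ps; have := perm_size ps; rewrite /= !size_cat /= => sz.
have s0 : s = [::].
  by apply: size0nil; rewrite /s !size_cat; lia.
have cs0 : cs = [::].
  case: cs szcs sz {ps} => // c' cs /andP[szc' _].
  by rewrite /= size_cat; lia.
move: ps; rewrite s0 cs0 /= cats0 big_nil mul1r big_seq1.
case/perm_eq_pair=> ->; rewrite /lcomm /= /lie.
  by exists 1, (-1); rewrite comb2_lie.
by exists (-1), 1; rewrite comb2C comb2_lie.
Qed.

Lemma proper_polys_lie :
  proper_polys F n1 n2 n3 n4 (lie (fvar F x0) (fvar F x1)).
Proof.
apply: lin_span_gen; exists [::], [::], [::], [:: [:: x0; x1]]; split=> //.
  by rewrite varsE.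
by rewrite !big_nil !mul1r big_seq1.
Qed.

(** The subtraction [1 - v.2] is truncated; only the variables numbered 0 and 1 matter. *)
Definition swap_poly (e : bool) : freeAlg F -> freeAlg F :=
  evalX (fun v : var => fvar F (v.1, if e then (1 - v.2)%N else v.2)).

Lemma evalX_fvar_comb2 (g : var -> var) l m :
  evalX (fun v => fvar F (g v)) (comb2 (fvar F x0) (fvar F x1) l m) =
  comb2 (fvar F (g x0)) (fvar F (g x1)) l m.
Proof.
have e0 := evalX_fvar (fun v => fvar F (g v)) x0.
have e1 := evalX_fvar (fun v => fvar F (g v)) x1.
move: (fvar F x0) (fvar F x1) e0 e1 => a b <- <-.
by apply: evalX_comb2 => c x; apply: malg_mulr_scalar.
Qed.

Lemma swap_poly_comb2 e l m :
  swap_poly e (comb2 (fvar F x0) (fvar F x1) l m) =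
  if e then comb2 (fvar F x0) (fvar F x1) m l
  else comb2 (fvar F x0) (fvar F x1) l m.
Proof.
rewrite [LHS](evalX_fvar_comb2 (fun v => (v.1,
  if e then (1 - v.2)%N else v.2))).
case: e; first exact: comb2C.
exact: erefl.
Qed.

End TwoVariables.

Lemma perm2E (s : 'S_2) (i : 'I_2) :
  s i = (if odd_perm s then 1 - i else i)%N :> nat.
Proof.
have [s0|s0] := eqVneq (s ord0) ord0.
  have -> : s = 1%g.
    apply/permP => j; rewrite perm1.
    have : s (lift ord0 ord0) != s ord0 by rewrite (inj_eq perm_inj).
    rewrite s0; have [->|j0] := eqVneq j ord0; first by [].
    have -> : j = lift ord0 ord0 by apply: val_inj; case: j j0 => [[|[|]]].
    by move=> h; apply: val_inj; case: (s _) h => [[|[|]]].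
  by rewrite odd_perm1 perm1.
have -> : s = tperm ord0 (lift ord0 ord0).
  have s01 : s ord0 = lift ord0 ord0.
    by apply: val_inj; case: (s _) s0 => [[|[|]]].
  apply/permP => j; have [->|j0] := eqVneq j ord0; first by rewrite tpermL.
  have -> : j = lift ord0 ord0 by apply: val_inj; case: j j0 => [[|[|]]].
  have : s (lift ord0 ord0) != s ord0 by rewrite (inj_eq perm_inj).
  rewrite tpermR s01 => h; apply: val_inj.
  by case: (s _) h => [[|[|]]].
rewrite odd_tperm /=; case: (eqVneq i ord0) => [->|i0]; first by rewrite tpermL.
have -> : i = lift ord0 ord0 by apply: val_inj; case: i i0 => [[|[|]]].
by rewrite tpermR.
Qed.

Lemma shift_perm2E (s : 'S_2) (j : nat) : (j < 2)%N ->
  shift_perm 0 s j = if odd_perm s then (1 - j)%N else j.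
Proof.
by move=> j2; rewrite /shift_perm leq0n subn0 insubT add0n perm2E.
Qed.

Lemma sum_partitions_0 (F : fieldType) (g : seq nat -> F) :
  \sum_(l <- partitions 0) g l = g [::].
Proof. by rewrite partitions_0 big_seq1. Qed.

Lemma sum_partitions_2 (F : fieldType) (g : seq nat -> F) :
  \sum_(l <- partitions 2) g l = g [:: 2%N] + g [:: 1%N; 1%N].
Proof. by rewrite partitions_2 big_cons big_seq1. Qed.

(** * From multiplicities to noncommuting elements *)

Section ProperMultiplicity.
Variables (F : fieldType) (charF : [pchar F]%R =i pred0) (A : starAlg F).
Variables (t : vtype) (n1 n2 n3 n4 : nat).
Hypothesis varsE : proper_vars n1 n2 n3 n4 = [:: (t, 0%N); (t, 1%N)].
Local Notation a := (fvar F (t, 0%N)).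
Local Notation b := (fvar F (t, 1%N)).
Local Notation V := (proper_polys F n1 n2 n3 n4).

Definition two_variable_character :=
  swap_character V (star_id A) (@swap_poly F).

(** A permutation of two letters is determined by its sign, so any renaming [g] with the right
    effect on the two variables acts on V as the swap; [perm_var] for each of the four types is an
    instance. *)
Lemma two_variable_characterE (g : 'S_2 -> var -> var) c2 c11 :
  (forall s j, (j < 2)%N ->
     g s (t, j) = (t, if odd_perm s then (1 - j)%N else j)) ->
  two_variable_character c2 c11 <->
  exists d (e : 'I_d -> freeAlg F), basis_mod V (star_id A) e /\
    forall s (M : 'M[F]_d),
      (forall i, star_id A (evalX (fun v => fvar F (g s v)) (e i)
                            - \sum_j M i j *: e j)) ->
      \tr M = c2%:R + c11%:R * (-1) ^+ odd_perm s.
Proof.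
move=> gE; have actE s f : V f ->
    evalX (fun v => fvar F (g s v)) f = swap_poly (odd_perm s) f.
  move=> /(proper_polys_comb2 varsE)[l [m ->]].
  rewrite [LHS]evalX_fvar_comb2 [RHS]evalX_fvar_comb2 !gE //.
split=> -[d [e [eB tr]]]; exists d, e; split=> //; have [Ve _ _] := eB.
  by move=> s M WM; apply: tr => i; rewrite -actE.
move=> o M WM; pose s : 'S_2 := if o then tperm ord0 (lift ord0 ord0) else 1%g.
have so : odd_perm s = o by rewrite /s; case: (o);
  rewrite ?odd_tperm ?odd_perm1.
by rewrite -so; apply: tr => i; rewrite actE // so.
Qed.

(** [K] is the set of admissible multiplicities. The default of [xget] is 0, so the value 1 must
    come from a member of [K]; conversely, with a noncommuting pair [K] is nonempty and 1 is its
    only member. *)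
Lemma xget_two_variable (K : set nat) :
  (forall c11, K c11 <-> exists c2, two_variable_character c2 c11) ->
  xget 0%N K = 1%N <-> noncommuting A t.
Proof.
move=> KE.
have sV := lin_span_subspace _ : subspace V.
have sW := star_id_subspace A.
have VL := proper_polys_lie F varsE.
have VC := @proper_polys_comb2 F _ _ _ _ _ varsE.
have WS := @star_id_swap F t A.
have PC := @swap_poly_comb2 F t.
have eq1 c2 c11 : two_variable_character c2 c11 ->
    c11 = 1%N <-> ~ star_id A (lie a b).
  apply: (@swap_character_eq1 F charF _ V (star_id A) (a * b) (b * a)
    (@swap_poly F) sW VC VL WS PC).
have WE := star_id_lie A t.
split=> [K1|nc].
  have : K (xget 0%N K) by case: xgetP K1 => // k -> Kk _.
  rewrite K1 => /KE[c2 /eq1[/(_ erefl) nW _]].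
  by apply: contrapT => /WE.
have nW : ~ star_id A (lie a b) by move=> /WE.
have [c2 c2E] : exists c2, two_variable_character c2 1.
  exact: (@swap_character_exists F _ V (star_id A) (a * b) (b * a) (@swap_poly
    F) sV sW VC VL WS PC nW).
have : K (xget 0%N K) by apply: xgetPex; exists 1%N; apply/KE; exists c2.
by move=> /KE[c2' /eq1[_]]; apply.
Qed.

End ProperMultiplicity.

Section Multiplicities.
Variables (F : fieldType) (charF : [pchar F]%R =i pred0) (A : starAlg F).

Lemma perm0E (s : 'S_0) : s = 1%g.
Proof. by apply/permP => -[]. Qed.

Let sumE := (sum_partitions_0, sum_partitions_2, specht_char_nil,
  specht_char_2, specht_char_11, mulr1, mul1r).

Lemma proper_mult_sym0 :
  proper_mult A [:: 1; 1]%N [::] [::] [::] = 1%N <-> noncommuting A sym0.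
Proof.
apply: (@xget_two_variable F charF A sym0 2 0 0 0) => // c11.
pose g (s : 'S_2) := perm_var s (1%g : 'S_0) (1%g : 'S_0) (1%g : 'S_0).
have gE (s : 'S_2) j : (j < 2)%N ->
    g s (sym0, j) = (sym0, if odd_perm s then (1 - j)%N else j).
  by move=> j2; rewrite /g /perm_var /= shift_perm2E.
have charE := @two_variable_characterE F A sym0 2 0 0 0 erefl g _ c11 gE.
split=> [[m [d [e [eB tr]]] <-]|[c2 /charE[d [e [eB tr]]]]].
  exists (m [:: 2%N] [::] [::] [::]).
  apply/(@two_variable_characterE F A sym0 2 0 0 0 erefl g _ _ gE).
  by exists d, e; split=> [//|s M WM]; rewrite (tr _ _ _ _ _ WM) !sumE.
(* The only other partition of 2 is (2), which receives [c2]. *)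
exists (fun l _ _ _ => if l == [:: 1; 1]%N then c11 else c2) => //.
exists d, e; split=> [//|s1 s2 s3 s4 M].
by rewrite (perm0E s2) (perm0E s3) (perm0E s4) => /tr ->; rewrite !sumE.
Qed.

Lemma proper_mult_skew0 :
  proper_mult A [::] [:: 1; 1]%N [::] [::] = 1%N <-> noncommuting A skew0.
Proof.
apply: (@xget_two_variable F charF A skew0 0 2 0 0) => // c11.
pose g (s : 'S_2) := perm_var (1%g : 'S_0) s (1%g : 'S_0) (1%g : 'S_0).
have gE (s : 'S_2) j : (j < 2)%N ->
    g s (skew0, j) = (skew0, if odd_perm s then (1 - j)%N else j).
  by move=> j2; rewrite /g /perm_var /= shift_perm2E.
have charE := @two_variable_characterE F A skew0 0 2 0 0 erefl g _ c11 gE.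
split=> [[m [d [e [eB tr]]] <-]|[c2 /charE[d [e [eB tr]]]]].
  exists (m [::] [:: 2%N] [::] [::]).
  apply/(@two_variable_characterE F A skew0 0 2 0 0 erefl g _ _ gE).
  by exists d, e; split=> [//|s M WM]; rewrite (tr _ _ _ _ _ WM) !sumE.
exists (fun _ l _ _ => if l == [:: 1; 1]%N then c11 else c2) => //.
exists d, e; split=> [//|s1 s2 s3 s4 M].
by rewrite (perm0E s1) (perm0E s3) (perm0E s4) => /tr ->; rewrite !sumE.
Qed.

Lemma proper_mult_sym1 :
  proper_mult A [::] [::] [:: 1; 1]%N [::] = 1%N <-> noncommuting A sym1.
Proof.
apply: (@xget_two_variable F charF A sym1 0 0 2 0) => // c11.
pose g (s : 'S_2) := perm_var (1%g : 'S_0) (1%g : 'S_0) s (1%g : 'S_0).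
have gE (s : 'S_2) j : (j < 2)%N ->
    g s (sym1, j) = (sym1, if odd_perm s then (1 - j)%N else j).
  by move=> j2; rewrite /g /perm_var /= shift_perm2E.
have charE := @two_variable_characterE F A sym1 0 0 2 0 erefl g _ c11 gE.
split=> [[m [d [e [eB tr]]] <-]|[c2 /charE[d [e [eB tr]]]]].
  exists (m [::] [::] [:: 2%N] [::]).
  apply/(@two_variable_characterE F A sym1 0 0 2 0 erefl g _ _ gE).
  by exists d, e; split=> [//|s M WM]; rewrite (tr _ _ _ _ _ WM) !sumE.
exists (fun _ _ l _ => if l == [:: 1; 1]%N then c11 else c2) => //.
exists d, e; split=> [//|s1 s2 s3 s4 M].
by rewrite (perm0E s1) (perm0E s2) (perm0E s4) => /tr ->; rewrite !sumE.
Qed.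

Lemma proper_mult_skew1 :
  proper_mult A [::] [::] [::] [:: 1; 1]%N = 1%N <-> noncommuting A skew1.
Proof.
apply: (@xget_two_variable F charF A skew1 0 0 0 2) => // c11.
pose g (s : 'S_2) := perm_var (1%g : 'S_0) (1%g : 'S_0) (1%g : 'S_0) s.
have gE (s : 'S_2) j : (j < 2)%N ->
    g s (skew1, j) = (skew1, if odd_perm s then (1 - j)%N else j).
  by move=> j2; rewrite /g /perm_var /= shift_perm2E.
have charE := @two_variable_characterE F A skew1 0 0 0 2 erefl g _ c11 gE.
split=> [[m [d [e [eB tr]]] <-]|[c2 /charE[d [e [eB tr]]]]].
  exists (m [::] [::] [::] [:: 2%N]).
  apply/(@two_variable_characterE F A skew1 0 0 0 2 erefl g _ _ gE).
  by exists d, e; split=> [//|s M WM]; rewrite (tr _ _ _ _ _ WM) !sumE.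
exists (fun _ _ _ l => if l == [:: 1; 1]%N then c11 else c2) => //.
exists d, e; split=> [//|s1 s2 s3 s4 M].
by rewrite (perm0E s1) (perm0E s2) (perm0E s3) => /tr ->; rewrite !sumE.
Qed.

End Multiplicities.

Theorem lemma4p3 (R : realType) (F : fieldType) (charF : [pchar F]%R =i pred0)
    (A : starAlg F) (hFJ : type_F_plus_J A) (hgrowth : quadratic_growth R A) :
  [/\ proper_mult A [:: 1; 1] [::] [::] [::] = 1 <-> in_var A (U3_star F),
      proper_mult A [::] [:: 1; 1] [::] [::] = 1 <-> in_var A (G2_tau F),
      proper_mult A [::] [::] [:: 1; 1] [::] = 1 <-> in_var A (G2_gr_psi F)
    & proper_mult A [::] [::] [::] [:: 1; 1] = 1 <-> in_var A (G2_gr_tau F)]%N.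
Proof.
split.
- by rewrite proper_mult_sym0 // U3_in_var.
- by rewrite proper_mult_skew0 // G2_tau_in_var.
- by rewrite proper_mult_sym1 // G2_gr_psi_in_var.
- by rewrite proper_mult_skew1 // G2_gr_tau_in_var.
Qed.
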